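(* Assume the Generalized Continuum Hypothesis, let $\aleph_\alpha$ be a regular cardinal, and let $\mathbf{C}_\alpha$ be the circular $\alpha$-set. Then: (1) Every automorphism of the group $\mathrm{Aut}(\mathbf C_\alpha)$ is of the form $g\mapsto\tau g\tau^{-1}$ for a unique bijection $\tau$ of $\mathbf C_\alpha$ preserving or reversing orientation, and conversely each such $\tau$ induces an automorphism, so $\mathrm{Aut}(\mathrm{Aut}(\mathbf C_\alpha))=\mathrm{Aut}(\mathbf C_\alpha^{rel})$; moreover $\mathrm{Aut}(\mathbf C_\alpha^{rel})$ is a complete group. (2) The same holds for the Dedekind completion: $\mathrm{Aut}(\mathrm{Aut}(\bar{\mathbf C}_\alpha))=\mathrm{Aut}(\bar{\mathbf C}_\alpha^{rel})$, and $\mathrm{Aut}(\bar{\mathbf C}_\alpha^{rel})$ is a complete group.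
   Context: An $\alpha$-set is a chain $L$ of cardinality $\aleph_\alpha$ such that for any subsets $U_1<U_2$ of $L$ (possibly empty) of cardinality less than $\aleph_\alpha$ there is $a\in L$ with $U_1<a<U_2$. Under GCH, for regular $\aleph_\alpha$ an $\alpha$-set $\mathbf L_\alpha$ exists and is unique up to order-isomorphism. The circular $\alpha$-set $\mathbf C_\alpha$ is the circle $(\mathbf L_\alpha,\mathrm{Cr})$ with $\mathrm{Cr}(x,y,z)$ iff $x<y<z$ or $y<z<x$ or $z<x<y$. For a circle $C$, $\mathrm{Aut}(C)$ is the group of $\mathrm{Cr}$-preserving bijections and $\mathrm{Aut}(C^{rel})$ the group of bijections preserving or reversing orientation. $\bar C$ is the Dedekind completion (completion of the underlying chain, with one endpoint adjoined if it has none, circularized). A group is complete if it has trivial center and every automorphism is inner. *)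

(* Defs.v *)
From HB Require Import structures.
From mathcomp Require Import all_boot all_order.
From mathcomp Require Import boolp classical_sets functions cardinality.

Set Implicit Arguments.
Unset Strict Implicit.
Unset Printing Implicit Defensive.

Import Order.TTheory.
Local Open Scope classical_set_scope.
Local Open Scope card_scope.
Local Open Scope group_scope.

Definition card_lt T U (A : set T) (B : set U) : bool :=
  (A #<= B) && ~~ (B #<= A).

(* No cardinality lies strictly between an infinite cardinal and the
   cardinality of its power set. *)
Definition GCH : Prop :=
  forall T U : Type,
    infinite_set [set: T] ->
    [set: T] #<= [set: U] -> [set: U] #<= [set: set T] ->
    [set: U] #= [set: T] \/ [set: U] #= [set: set T].

(* A cardinal is represented by an arbitrary type of that cardinality; by
   choice the infinite ones are exactly the alephs.  Regularity: a union of
   fewer than K sets, each of size less than K, has size less than K. *)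
Definition regular_cardinal (K : Type) : Prop :=
  infinite_set [set: K] /\
  forall (I : set K) (F : K -> set K),
    card_lt I [set: K] ->
    (forall i, I i -> card_lt (F i) [set: K]) ->
    card_lt (\bigcup_(i in I) F i) [set: K].

Definition alpha_set (K : Type) d (L : orderType d) : Prop :=
  [set: L] #= [set: K] /\
  forall U1 U2 : set L,
    card_lt U1 [set: K] -> card_lt U2 [set: K] ->
    (forall u1 u2, U1 u1 -> U2 u2 -> (u1 < u2)%O) ->
    exists a : L, (forall u1, U1 u1 -> (u1 < a)%O) /\
                  (forall u2, U2 u2 -> (a < u2)%O).

(* The circle obtained from the chain T is the pair (T, Cr T). *)
Definition Cr d (T : orderType d) (x y z : T) : bool :=
  [|| (x < y < z)%O, (y < z < x)%O | (z < x < y)%O].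
Arguments Cr {d} T x y z.

Section DedekindCompletion.
Context (d : Order.disp_t) (T : orderType d).

Definition has_endpoint : Prop := has_ubound [set: T] \/ has_lbound [set: T].

(* When T has no endpoint, the full cut [set: T] is allowed: it is the single
   top point adjoined to the completion.  When T has an endpoint, the cuts are
   those of the conditionally complete completion and nothing is adjoined. *)
Definition dedekind_cut (A : set T) : Prop :=
  [/\ A = lbound (ubound A), A !=set0 & has_endpoint -> has_ubound A].

Record dedekind : Type := Dedekind {
  lower_part : set T;
  dedekindP : dedekind_cut lower_part }.

HB.instance Definition _ := gen_eqMixin dedekind.
HB.instance Definition _ := gen_choiceMixin dedekind.

Definition dedekind_le (A B : dedekind) : bool :=
  `[< lower_part A `<=` lower_part B >].

Lemma dedekind_inj : injective lower_part.
Proof.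
by move=> [A pA] [B pB] /= eAB; case: B / eAB pB => pB;
  rewrite (Prop_irrelevance pA pB).
Qed.

Lemma dedekind_le_refl : reflexive dedekind_le.
Proof. by move=> A; apply/asboolP. Qed.

Lemma dedekind_le_anti : antisymmetric dedekind_le.
Proof.
move=> A B /andP[/asboolP AB /asboolP BA].
by apply: dedekind_inj; apply/seteqP.
Qed.

Lemma dedekind_le_trans : transitive dedekind_le.
Proof.
move=> B A C /asboolP AB /asboolP BC.
by apply/asboolP; exact: subset_trans BC.
Qed.

Lemma dedekind_le_total : total dedekind_le.
Proof.
move=> A B; apply/orP; case: (pselect (lower_part A `<=` lower_part B)) => AB.
  by left; apply/asboolP.
right; apply/asboolP => b Bb.
have [a [Aa nBa]] : exists a, lower_part A a /\ ~ lower_part B a.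
  apply: contrapT => /forallNP nE; apply: AB => a Aa.
  by apply: contrapT => nBa; apply: (nE a).
have ba : (b <= a)%O.
  rewrite leNgt; apply/negP => ab; apply: nBa.
  case: (dedekindP B) => -> _ _ u uB.
  by apply: le_trans (ltW ab) (uB _ Bb).
case: (dedekindP A) => -> _ _ u uA.
exact: le_trans ba (uA _ Aa).
Qed.

HB.instance Definition _ := Order.Le_isPOrder.Build d dedekind
  dedekind_le_refl dedekind_le_anti dedekind_le_trans.
HB.instance Definition _ :=
  Order.POrder_isTotal.Build d dedekind dedekind_le_total.

End DedekindCompletion.
Arguments dedekind {d} T.

Section SymmetricGroup.
Context (T : Type).

Record sym : Type := Sym {
  sym_fun :> T -> T;
  sym_inv_fun : T -> T;
  sym_funK : cancel sym_fun sym_inv_fun;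
  sym_inv_funK : cancel sym_inv_fun sym_fun }.

Lemma sym_ext (f g : sym) : f =1 g -> f = g.
Proof.
case: f g => f f' fK f'K [g g' gK g'K] /= fg.
have efg : f = g by apply: funext.
case: g / efg fg gK g'K => _ gK g'K.
have efg' : f' = g' by apply: funext => x; rewrite -{1}[x]g'K fK.
case: g' / efg' gK g'K => gK g'K.
by rewrite (Prop_irrelevance gK fK) (Prop_irrelevance g'K f'K).
Qed.

HB.instance Definition _ := gen_eqMixin sym.
HB.instance Definition _ := gen_choiceMixin sym.

Definition sym_one : sym := @Sym id id (fun=> erefl) (fun=> erefl).

(* Composition is right to left: (f * g) x = f (g x). *)
Definition sym_mul (f g : sym) : sym :=
  @Sym (f \o g) (sym_inv_fun g \o sym_inv_fun f)
    (can_comp (@sym_funK f) (@sym_funK g))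
    (can_comp (@sym_inv_funK g) (@sym_inv_funK f)).

Definition sym_inv (f : sym) : sym :=
  @Sym (sym_inv_fun f) f (@sym_inv_funK f) (@sym_funK f).

Lemma sym_mulA : associative sym_mul.
Proof. by move=> f g h; apply: sym_ext. Qed.
Lemma sym_mul1 : left_id sym_one sym_mul.
Proof. by move=> f; apply: sym_ext. Qed.
Lemma sym_mulr1 : right_id sym_one sym_mul.
Proof. by move=> f; apply: sym_ext. Qed.
Lemma sym_mulV : left_inverse sym_one sym_inv sym_mul.
Proof. by move=> f; apply: sym_ext => x /=; rewrite sym_funK. Qed.
Lemma sym_mulrV : right_inverse sym_one sym_inv sym_mul.
Proof. by move=> f; apply: sym_ext => x /=; rewrite sym_inv_funK. Qed.

HB.instance Definition _ := isGroup.Build sym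
  sym_mulA sym_mul1 sym_mulr1 sym_mulV sym_mulrV.

End SymmetricGroup.

Section CircleAutomorphisms.
Context (T : Type) (R : T -> T -> T -> bool).

Definition preserving (f : T -> T) : Prop :=
  forall x y z, R (f x) (f y) (f z) = R x y z.

Definition reversing (f : T -> T) : Prop :=
  forall x y z, R (f x) (f y) (f z) = R z y x.

Definition is_aut : pred (sym T) := fun f => `[< preserving f >].

Definition is_relaut : pred (sym T) :=
  fun f => `[< preserving f \/ reversing f >].

Record circle_aut : Type := CircleAut {
  circle_aut_val :> sym T;
  circle_autP : is_aut circle_aut_val }.

Record circle_relaut : Type := CircleRelaut {
  circle_relaut_val :> sym T;
  circle_relautP : is_relaut circle_relaut_val }.

HB.instance Definition _ := [isSub for circle_aut_val].
HB.instance Definition _ := [Choice of circle_aut by <:].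
HB.instance Definition _ := [isSub for circle_relaut_val].
HB.instance Definition _ := [Choice of circle_relaut by <:].

Lemma is_aut_closed : group_closed is_aut.
Proof.
split=> [|f g /asboolP pf /asboolP pg]; first by apply/asboolP.
apply/asboolP => x y z; rewrite pf -pg /=.
by rewrite !sym_inv_funK.
Qed.

Lemma is_relaut_closed : group_closed is_relaut.
Proof.
split=> [|f g /asboolP pf /asboolP pg]; first by apply/asboolP; left.
apply/asboolP; case: pf pg => [pf|pf] [pg|pg];
  [left|right|right|left] => x y z; rewrite pf -pg /=;
  by rewrite !sym_inv_funK.
Qed.

HB.instance Definition _ :=
  SubChoice_isSubGroup.Build (sym T) is_aut circle_aut is_aut_closed.
HB.instance Definition _ :=
  SubChoice_isSubGroup.Build (sym T) is_relaut circle_relaut is_relaut_closed.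

End CircleAutomorphisms.

Section GroupAutomorphisms.
Context (G : groupType).

Definition is_group_aut : pred (sym G) :=
  fun f => `[< {morph f : x y / x * y} >].

Record group_aut : Type := GroupAut {
  group_aut_val :> sym G;
  group_autP : is_group_aut group_aut_val }.

HB.instance Definition _ := [isSub for group_aut_val].
HB.instance Definition _ := [Choice of group_aut by <:].

Lemma is_group_aut_closed : group_closed is_group_aut.
Proof.
split=> [|f g /asboolP pf /asboolP pg]; first by apply/asboolP.
apply/asboolP => x y /=; rewrite -pf; congr (f _).
by apply: (can_inj (@sym_funK _ g)); rewrite pg !sym_inv_funK.
Qed.

HB.instance Definition _ :=
  SubChoice_isSubGroup.Build (sym G) is_group_aut group_aut is_group_aut_closed.

Definition complete_group : Prop :=
  (forall z : G, (forall g : G, commute z g) -> z = 1) /\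
  (forall phi : group_aut, exists a : G, forall g : G, phi g = a * g * a^-1).

End GroupAutomorphisms.

Definition is_conjugation T (R : T -> T -> T -> bool)
    (phi : group_aut (circle_aut R)) (tau : sym T) : Prop :=
  forall g : circle_aut R, (phi g : sym T) = tau * (g : sym T) * tau^-1.

(* Main.v *)
(** The group determines which pairs of elements have disjoint supports (Rubin):
    f and g with disjoint supports satisfy a first-order condition on commutators
    which in turn forces f and g^12 to have disjoint supports, and this suffices
    to express disjointness through centralizers.  In the completed circle, the
    subgroups of elements supported in an arc are then recovered as well: an
    automorphism phi maps the group of an arc onto the group of an open set U,
    and U is a single arc, because conjugating by the group of the source arc
    mixes any two of its elements.  So phi acts on arcs, hence on pairs of
    endpoints, and the pairs containing a given point p have images with exactly
    one common point tau p; tau preserves or reverses orientation and induces phi.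
    The argument applies to both groups of both circles, so completeness of the
    larger groups comes from the same statement.

    For the circle of the chain L itself it remains to see that tau maps L into
    L.  Otherwise tau(L) contains a gap q both of whose sides have the cofinality
    of L.  A diagonal construction gives another such gap r outside tau(L), and
    by back and forth some automorphism maps q to r, although tau(L) is
    invariant. *)

Require Import Defs.
From HB Require Import structures.
From mathcomp Require Import all_boot all_order.
From mathcomp Require Import boolp classical_sets functions cardinality.
From mathcomp Require wochoice.
From mathcomp Require Import zify.
From Stdlib Require Inverse_Image.

Set Implicit Arguments.
Unset Strict Implicit.
Unset Printing Implicit Defensive.

Import Order.TTheory.
Local Open Scope classical_set_scope.
Local Open Scope card_scope.
Local Open Scope group_scope.

(** * Circular orders *)

(** Every group involved is made to act on the completed circle, the groups of [L] through the
    unique extension of their elements, so that a single theorem about an abstract action,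
    [reconstruction], serves four groups. Plain commutation says little about supports: rotations
    may commute although they move every point. Rubin's condition asks instead for nontrivial double
    commutators that commute with [g]. It controls only points with enough distinct iterates under
    [g], whence the passage to a power. An element supported in an arc is monotone there, so for
    such elements the power loses no support. Centralizers then see supports only up to closure.
    This suffices because two open sets are disjoint exactly when the intersection of their closures
    has empty interior. An abstract automorphism may reverse the circle, so endpoints of arcs are
    first recovered as unordered pairs, and the orientation is settled globally afterwards. The
    condition on the two sides of [q] is forced: automorphisms of the chain preserve the
    cofinalities of a gap, so homogeneity can be expected only among gaps of one kind. *)

Lemma rank_exists d (T : orderType d) (s : seq T) :
  exists f : T -> nat, forall x y, x \in s -> y \in s ->
    ((x < y)%O = (f x < f y)) * ((x == y) = (f x == f y)).
Proof.
pose f x := count (fun z => z < x)%O s; exists f.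
have lt x y : x \in s -> (x < y)%O -> f x < f y.
  move=> xs xy; apply: (@leq_trans (f x + count (pred1 x) s)).
    by rewrite -addn1 leq_add2l -has_count has_pred1.
  rewrite /f -count_predUI addnC (@eq_count _ _ pred0) ?count_pred0; last first.
    by move=> z /=; apply/andP => -[+ /eqP zx]; rewrite zx ltxx.
  apply: sub_count => z /= /orP[zx|/eqP->//]; exact: lt_trans xy.
move=> x y xs ys; case: (ltgtP x y) => [xy|yx|->]; last by rewrite ltnn eqxx.
  by have := lt _ _ xs xy; case: ltngtP.
by have := lt _ _ ys yx; case: ltngtP.
Qed.

(** Positions replace membership proofs, so that in [cyc] the side conditions are closed numerals
    checked by computation. *)
Lemma rank_nth d (T : orderType d) (x0 : T) (s : seq T) :
  exists f : nat -> nat, forall i j, i < size s -> j < size s ->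
    ((nth x0 s i < nth x0 s j)%O = (f i < f j)) *
    ((nth x0 s i == nth x0 s j) = (f i == f j)).
Proof.
have [f fP] := rank_exists s; exists (fun i => f (nth x0 s i)) => i j si sj.
exact: fP (mem_nth _ si) (mem_nth _ sj).
Qed.

Ltac index_in x s :=
  lazymatch s with
  | x :: _ => constr:(0)
  | _ :: ?s' => let n := index_in x s' in constr:(S n)
  end.

(* Decides statements about the order, hence about [Cr], of the points in [s],
   which must be nonempty, by replacing these points with their ranks. *)
Ltac cyc s :=
  let x0 := lazymatch s with ?x :: _ => x end in
  let f := fresh "f" in let H := fresh "H" in
  have [f H] := rank_nth x0 s;
  rewrite /Cr;
  repeat match goal with
  | |- context [(?x < ?y)%O] =>
      let i := index_in x s in let j := index_in y s in
      rewrite [(x < y)%O](fst (H i j isT isT))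
  | |- context [(?x == ?y)] =>
      let i := index_in x s in let j := index_in y s in
      rewrite [x == y](snd (H i j isT isT))
  end; clear; lia.

Section Homo.
Context {d d' : Order.disp_t} {T : orderType d} {T' : orderType d'} (f : T -> T').

(** A triple that is not positively oriented is degenerate or has a positively oriented reversal,
    and the image of that reversal excludes the image of the triple. *)
Lemma Cr_homo : (forall x y z, Cr T x y z -> Cr T' (f x) (f y) (f z)) ->
  forall x y z, Cr T' (f x) (f y) (f z) = Cr T x y z.
Proof.
move=> h x y z; apply/idP/idP; last exact: h.
apply: contraTT => nxyz.
have [->|xy] := eqVneq x y; first by cyc [:: f y; f z].
have [->|yz] := eqVneq y z; first by cyc [:: f x; f z].
have [->|xz] := eqVneq x z; first by cyc [:: f y; f z].
have /h : Cr T z y x by move: nxyz xy yz xz; cyc [:: x; y; z].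
by cyc [:: f x; f y; f z].
Qed.

Lemma Cr_anti_homo : (forall x y z, Cr T x y z -> Cr T' (f z) (f y) (f x)) ->
  forall x y z, Cr T' (f x) (f y) (f z) = Cr T z y x.
Proof.
move=> h x y z; apply/idP/idP; last exact: h.
apply: contraTT => nxyz.
have [->|xy] := eqVneq x y; first by cyc [:: f y; f z].
have [->|yz] := eqVneq y z; first by cyc [:: f x; f z].
have [->|xz] := eqVneq x z; first by cyc [:: f y; f z].
have /h : Cr T x y z by move: nxyz xy yz xz; cyc [:: x; y; z].
by cyc [:: f x; f y; f z].
Qed.

End Homo.

Section Circle.
Context {d : Order.disp_t} {T : orderType d}.
Implicit Types (a b c e p q x y z : T).

Lemma CrC x y z : Cr T x y z = Cr T y z x.
Proof. by cyc [:: x; y; z]. Qed.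

Lemma Cr_neq x y z : Cr T x y z -> [/\ x != y, y != z & x != z].
Proof. by move=> h; split; move: h; cyc [:: x; y; z]. Qed.

Lemma Cr_anti x y z : Cr T x y z -> ~~ Cr T z y x.
Proof. cyc [:: x; y; z]. Qed.

Lemma Cr_total x y z : x != y -> y != z -> x != z -> Cr T x y z || Cr T z y x.
Proof. cyc [:: x; y; z]. Qed.

(** Arcs form a base of a topology: on each side of [x] the nearer of the two endpoints is kept. *)
Lemma arc_inter a b c e x : Cr T a x b -> Cr T c x e ->
  exists p q, Cr T p x q /\ forall y, Cr T p y q -> Cr T a y b /\ Cr T c y e.
Proof.
move=> axb cxe.
exists (if Cr T a c x then c else a), (if Cr T x b e then b else e).
split; first by do 2 case: ifP; move: axb cxe; cyc [:: a; b; c; e; x].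
move=> y; split; move: H axb cxe; do 2 case: ifP; cyc [:: a; b; c; e; x; y].
Qed.

Definition relaut (f : T -> T) := preserving (Cr T) f \/ reversing (Cr T) f.

Lemma relaut_sym_inv (f : sym T) : relaut f -> relaut (sym_inv_fun f).
Proof.
by case=> h; [left|right] => x y z; rewrite -h !sym_inv_funK.
Qed.

Lemma relaut_comp (f g : T -> T) : relaut f -> relaut g -> relaut (f \o g).
Proof.
by case=> hf [hg|hg]; [left|right|right|left] => x y z /=; rewrite hf hg.
Qed.

Hypothesis dense : forall a b, a != b -> exists x, Cr T a x b.

(** Continuity of [f]: points [u] and [v] cut the circle into an arc around [x] and an arc around
    [f x], and the preimage of the latter is again an arc around [x]. *)
Lemma wiggle (f : sym T) x : relaut f -> f x != x ->
  exists a b, Cr T a x b /\ forall y, Cr T a y b -> ~~ Cr T a (f y) b.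
Proof.
move=> rf fx; have [v fxvx] := dense fx; have [u xufx] : exists u, Cr T x u (f x).
  by apply: dense; rewrite eq_sym.
have vxu : Cr T v x u by move: fxvx xufx; cyc [:: x; f x; u; v].
have ufxv : Cr T u (f x) v by move: fxvx xufx; cyc [:: x; f x; u; v].
have [c [e [cxe ce]]] : exists c e, Cr T c x e /\ forall y, Cr T c y e -> Cr T u (f y) v.
  case: rf => rf.
    exists (sym_inv_fun f u), (sym_inv_fun f v).
    by split=> [|y]; rewrite -rf !sym_inv_funK.
  exists (sym_inv_fun f v), (sym_inv_fun f u).
  by split=> [|y]; rewrite -rf !sym_inv_funK.
have [p [q [pxq pq]]] := arc_inter vxu cxe.
exists p, q; split=> // y /pq[vyu /ce ufyv]; apply/negP => /pq[vfyu _].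
by move: ufyv vfyu; cyc [:: u; v; f y].
Qed.

End Circle.

(** * Disjoint supports *)

Section Commutators.
Context {G : groupType}.
Implicit Types f g h : G.

Lemma commg_commuting f g h :
  commute h f -> commute h g -> [~ f, g * h] = [~ f, g].
Proof.
move=> hf hg; have hfg : commute h [~ f, g].
  by rewrite /commg /conjg; repeat first [apply: commuteM | apply: commuteV].
rewrite -[RHS](mulKg h) hfg /commg /conjg invgM !mulgA.
by congr (_ * _ * _ * _ * _); rewrite -!invgM hf.
Qed.

(** Rubin's first-order condition. The element [f] enters only through the [h] that do not commute
    with it; the double commutator localizes such an [h] near a point moved by both. *)
Definition alg_disjoint f g := forall h, ~ commute f h ->
  exists f1 f2, [/\ commute f1 g, commute f2 g, [~ f1, [~ f2, h]] != 1 &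
    commute [~ f1, [~ f2, h]] g].

(** The group-theoretic form of the inclusion of the support of [u] in the closure of the support of
    [f]; see [alg_supportP]. *)
Definition alg_support f u := forall g, alg_disjoint f g -> commute u (g ^+ 12).

End Commutators.

Lemma alg_disjointM (G : groupType) (phi psi : UMagmaMorphism.type G G)
    (phiK : cancel phi psi) (psiK : cancel psi phi) f g :
  alg_disjoint f g -> alg_disjoint (phi f) (phi g).
Proof.
move=> fg h nfh; have [|f1 [f2 [c1 c2 n1 c3]]] := fg (psi h).
  by move=> c; apply: nfh; have := gmulf_commute phi c; rewrite psiK.
exists (phi f1), (phi f2); rewrite -[h]psiK -!(gmulfR phi); split.
- exact: gmulf_commute.
- exact: gmulf_commute.
- by rewrite gmulf_eq1//; apply: can_inj phiK.
- exact: gmulf_commute.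
Qed.

Lemma alg_supportM (G : groupType) (phi psi : UMagmaMorphism.type G G)
    (phiK : cancel phi psi) (psiK : cancel psi phi) f u :
  alg_support f u -> alg_support (phi f) (phi u).
Proof.
move=> fu g fg; rewrite -[g]psiK -(gmulfXn phi); apply: gmulf_commute; apply: fu.
by rewrite -[f]phiK; exact: alg_disjointM fg.
Qed.

(** * Components of open sets and configurations of arcs *)

Section Component.
Context {d : Order.disp_t} {T : orderType d}.
Implicit Types (a b c e p q x y z : T).

(** Dedekind completeness of the chain obtained by opening the circle at [c]. Being stated through
    [Cr] alone, it passes to the dual order. *)
Definition arc_complete := forall c (S R : set T), S !=set0 -> R !=set0 ->
  (forall s r, S s -> R r -> Cr T c s r) ->
  exists q, (forall s, S s -> (s == q) || Cr T c s q) /\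
            (forall r, R r -> (q == r) || Cr T c q r).

Definition arc_open (U : set T) :=
  forall x, U x -> exists a b, Cr T a x b /\ forall y, Cr T a y b -> U y.

(** The point [b] is the first one outside [U] after [x], found as the end of the set [S] of points
    that precede the whole complement of [U] as seen from [x]. *)
Lemma component_right (U : set T) x :
    (forall a b, a != b -> exists x, Cr T a x b) -> arc_complete ->
    arc_open U -> U x -> ~` U !=set0 ->
  exists b, [/\ ~ U b, forall z, Cr T x z b -> U z & forall r, ~ U r -> (b == r) || Cr T x b r].
Proof.
move=> dense fill oU Ux [c nUc].
have nx r : ~ U r -> x != r by move=> nUr; apply: contra_notN nUr => /eqP<-.
have [u [v [uxv uv]]] := oU x Ux; have [_ xv _] := Cr_neq uxv.
have [s0 xs0v] := dense _ _ xv.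
pose S : set T := [set s | forall r, ~ U r -> Cr T x s r].
have Ss0 : S s0.
  move=> r nUr; have nr : ~~ Cr T u r v by apply/negP => /uv.
  by move: (nx _ nUr) uxv xs0v nr; cyc [:: x; r; u; v; s0].
have [||s r Ss nUr|b [Sb bT]] := fill x S (~` U).
- by exists s0.
- by exists c.
- exact: Ss.
have xb : x != b by move: (Sb _ Ss0) xs0v; cyc [:: x; b; s0; v].
exists b; split=> // [Ub|z xzb]; last first.
  by apply: contrapT => /bT; move: xzb; cyc [:: x; z; b].
(* If [b] were in [U], a point slightly beyond [b] would still belong to [S]. *)
have [p [q [pbq pq]]] := oU b Ub.
have [|s bs] := dense b (if Cr T b x q then x else q).
  by case: ifP; move: pbq xb; cyc [:: x; b; p; q].
have /Sb : S s.
  move=> r nUr; have rb : r != b by apply: contra_notN nUr => /eqP->.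
  have nr : ~~ Cr T p r q by apply/negP => /pq.
  by move: bs; case: ifP; move: rb nr (nx _ nUr) (bT _ nUr) pbq xb;
    cyc [:: x; b; p; q; r; s].
by move: bs; case: ifP; move: pbq xb; cyc [:: x; b; p; q; s].
Qed.

End Component.

(** Gives the left end of a component from the right end in the dual order. *)
Lemma Cr_dual d (T : orderType d) (x y z : T) : Cr T^d x y z = Cr T z y x.
Proof.
rewrite [LHS](_ : _ = [|| ((y < x) && (z < y))%O, ((z < y) && (x < z))%O
  | ((x < z) && (y < x))%O]); first by cyc [:: x; y; z].
by rewrite /Cr.
Qed.

Section Arcs.
Context {d : Order.disp_t} {T : orderType d}.
Implicit Types (a b c e p q x y z : T).
Hypothesis dense : forall a b, a != b -> exists x, Cr T a x b.
Hypothesis fill : @arc_complete d T.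

Lemma component (U : set T) x c e :
    arc_open U -> U x -> ~ U c -> ~ U e -> c != e ->
  exists a b, [/\ Cr T a x b, forall z, Cr T a z b -> U z, ~ U a & ~ U b].
Proof.
move=> oU Ux nUc nUe ce.
have nU0 : ~` U !=set0 by exists c.
have [b [nUb xbU bU]] := component_right dense fill oU Ux nU0.
have densed (a' b' : T^d) : a' != b' -> exists x', Cr T^d a' x' b'.
  rewrite eq_sym => /dense[z azb]; exists z; by rewrite Cr_dual.
have filld : @arc_complete _ T^d.
  move=> a S R S0 R0 SR; have [|q [Rq Sq]] := @fill a R S R0 S0.
    by move=> s r Rs Sr; have := SR _ _ Sr Rs; rewrite Cr_dual CrC CrC.
  exists q; split=> [s /Sq|r /Rq]; rewrite Cr_dual eq_sym.
    by rewrite CrC CrC.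
  by rewrite CrC CrC.
have oUd : @arc_open _ T^d U.
  move=> y /oU[a' [b' [ayb ab]]]; exists b', a'; rewrite Cr_dual; split=> // z.
  by rewrite Cr_dual => /ab.
have [a [nUa axU aU]] : exists a : T, [/\ ~ U a, forall z, Cr T a z x -> U z &
    forall r, ~ U r -> (a == r) || Cr T r a x].
  have [a [nUa axU aU]] := component_right densed filld oUd Ux nU0.
  exists a; split=> // [z|r /aU]; last by rewrite Cr_dual.
  by have := axU z; rewrite Cr_dual.
have ax : a != x by apply: contra_notN nUa => /eqP->.
have bx : b != x by apply: contra_notN nUb => /eqP->.
have axb : Cr T a x b.
  by move: (bU _ nUa) (aU _ nUb) (bU _ nUc) (aU _ nUc) (bU _ nUe) (aU _ nUe) ax bx ce;
    cyc [:: a; b; x; c; e].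
exists a, b; split=> // z azb; have [->//|zx] := eqVneq z x.
have [xzb|] := boolP (Cr T x z b); first exact: xbU.
by move=> h; apply: axU; move: h azb axb zx; cyc [:: a; b; x; z].
Qed.

(** If [c] came before [b], the points just after [c] would lie in both arcs; likewise for [a] and
    [e]. *)
Lemma disjoint_arcs a b c e : a != b -> c != e ->
  (forall x, Cr T a x b -> ~~ Cr T c x e) ->
  ((c == b) || Cr T a b c) && ((e == a) || Cr T c e a).
Proof.
move=> ab ce abce; have h1 : (c == b) || Cr T a b c.
  apply: contrapT => /negP nh.
  have [|x cx] := @dense c (if Cr T c b e then b else e).
    by case: ifP; move: ab ce nh; cyc [:: a; b; c; e].
  by case: ifP cx; move: (abce x) ab ce nh; cyc [:: a; b; c; e; x].
rewrite h1 /=; apply: contrapT => /negP nh.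
have [|x ax] := @dense a (if Cr T a b e then b else e).
  by case: ifP; move: ab ce nh h1; cyc [:: a; b; c; e].
by case: ifP ax; move: (abce x) ab ce nh h1; cyc [:: a; b; c; e; x].
Qed.

(** Three disjoint arcs with dense union leave no hole after [q]: otherwise the arc from [q] to the
    nearer of [r] and [t] would miss all three. *)
Lemma next_arc p q r s t w : p != q -> r != s -> t != w ->
    ((r == q) || Cr T p q r) && ((s == p) || Cr T r s p) ->
    ((t == q) || Cr T p q t) && ((w == p) || Cr T t w p) ->
    ((t == s) || Cr T r s t) && ((w == r) || Cr T t w r) ->
    (forall p' q', p' != q' -> exists x,
      Cr T p' x q' /\ [|| Cr T p x q, Cr T r x s | Cr T t x w]) ->
    (r == q) || (t == q).
Proof.
move=> pq rs tw d1 d2 d3 mx.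
apply: contrapT => /negP h.
have [|x [qx]] := mx q (if Cr T q r t then r else t).
  by case: ifP; move: h; cyc [:: p; q; r; s; t; w].
rewrite negb_or in h.
case/or3P=> hx; case: ifP qx.
- by move: h d1 hx; cyc [:: p; q; r; s; x; t].
- by move: h d2 hx; cyc [:: p; q; r; t; w; x].
- by move: h d1 hx; cyc [:: p; q; r; s; x; t].
- by move: h d1 d3 hx; cyc [:: q; r; s; x; t; p; w].
- by move: h d2 hx d3; cyc [:: q; t; w; x; r; p; s].
- by move: h d2 hx; cyc [:: p; q; r; x; t; w].
Qed.

(** Applying [next_arc] to each arc in turn closes them up into a triangle; the two alternatives are
    its two cyclic orders. *)
Lemma three_arcs a b c e u v : a != b -> c != e -> u != v ->
  (forall x, Cr T a x b -> ~~ Cr T c x e) ->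
  (forall x, Cr T a x b -> ~~ Cr T u x v) ->
  (forall x, Cr T c x e -> ~~ Cr T u x v) ->
  (forall p q, p != q -> exists x, Cr T p x q /\ [|| Cr T a x b, Cr T c x e | Cr T u x v]) ->
  [/\ c = b, u = e, v = a & Cr T a b e] \/ [/\ u = b, c = v, e = a & Cr T a b v].
Proof.
move=> ab ce uv d1 d2 d3 mx.
have := disjoint_arcs ab ce d1; have := disjoint_arcs ab uv d2.
have := disjoint_arcs ce uv d3 => {d1 d2 d3} d3 d2 d1.
have h1 := next_arc ab ce uv d1 d2 d3 mx.
have h2 : (a == e) || (u == e).
  apply: (next_arc ce ab uv _ d3 d2).
    by move: ab ce d1; cyc [:: a; b; c; e].
  by move=> p q /mx[x [pxq /or3P[]h]]; exists x; rewrite pxq h ?orbT.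
have h3 : (a == v) || (c == v).
  apply: (next_arc uv ab ce _ _ d1).
  - by move: ab uv d2; cyc [:: a; b; u; v].
  - by move: ce uv d3; cyc [:: c; e; u; v].
  by move=> p q /mx[x [pxq /or3P[]h]]; exists x; rewrite pxq h ?orbT.
case/orP: h1 => /eqP eb; rewrite {}eb {mx} in ce uv d1 d2 d3 h2 h3 *; [left|right].
  have /eqP ue : u == e by move: ab ce d1 d2 d3 h2; cyc [:: a; b; e; u; v].
  rewrite {}ue {h2} in uv d1 d2 d3 h3 *.
  have /andP[/eqP-> ->] : (v == a) && Cr T a b e.
    by move: ab ce uv d1 d2 d3 h3; cyc [:: a; b; e; v].
  by [].
have /eqP cv : c == v by move: ab uv d1 d2 d3 h3; cyc [:: a; b; c; e; v].
rewrite {}cv {h3} in ce d1 d2 d3 h2 *.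
have /andP[/eqP-> ->] : (e == a) && Cr T a b v.
  by move: ab ce uv d1 d2 d3 h2; cyc [:: a; b; e; v].
by [].
Qed.

Lemma arc_avoid a b p : a != b ->
  exists c e, c != e /\ forall x, Cr T c x e -> Cr T a x b && (x != p).
Proof.
move=> /dense[z azb]; have [azp|nazp] := boolP (Cr T a p z).
  exists z, b; split=> [|x]; first by move: azb; cyc [:: a; b; z].
  by move: azb azp; cyc [:: a; b; p; x; z].
exists a, z; split=> [|x]; first by move: azb; cyc [:: a; b; z].
by move: azb nazp; cyc [:: a; b; p; x; z].
Qed.

End Arcs.

(** * Supports of the elements of a group acting on a circle *)

Section Action.
Context {d : Order.disp_t} {X : orderType d} {G : groupType}.
Variable rho : UMagmaMorphism.type G (sym X).
Implicit Types (f g h u v : G) (a b c e p q x y z : X).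

Lemma rho1 x : rho 1 x = x. Proof. by rewrite gmulf1. Qed.
Lemma rhoE f g x : rho (f * g) x = rho f (rho g x). Proof. by rewrite gmulfM. Qed.
Lemma rhoK f : cancel (rho f) (rho f^-1).
Proof. by move=> x; rewrite -rhoE mulVg rho1. Qed.
Lemma rhoKV f : cancel (rho f^-1) (rho f).
Proof. by move=> x; rewrite -rhoE mulgV rho1. Qed.

Definition moves f x := rho f x != x.
Definition supported f a b := forall x, moves f x -> Cr X a x b.
Definition disj f g := forall x, moves f x -> ~~ moves g x.

Lemma movesPn f x : reflect (rho f x = x) (~~ moves f x).
Proof. by rewrite negbK; exact: eqP. Qed.

Lemma disj_sym f g : disj f g -> disj g f.
Proof. by move=> fg x gx; apply/negP => /fg; rewrite gx. Qed.

Lemma movesV f x : moves f^-1 x = moves f x.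
Proof.
apply/idP/idP; apply: contra_neq => fx; last by rewrite -{1}fx rhoKV.
by rewrite -{1}fx rhoK.
Qed.

Lemma moves_image f x : moves f x = moves f (rho f x).
Proof. by rewrite /moves (can_eq (rhoK f)). Qed.

Lemma moves_conj f g x : moves (f ^ g) x = moves f (rho g x).
Proof. by rewrite /moves /conjg !rhoE -(can_eq (rhoK g)) rhoKV. Qed.

Lemma moves_mul f g x : moves (f * g) x -> moves f x \/ moves g x.
Proof.
move=> fgx; have [gx|gx] := boolP (moves g x); first by right.
by left; move: fgx; rewrite /moves rhoE (movesPn _ _ gx).
Qed.

(** The inverse of [[~ f, g]] is [g^-1 * g ^ f], so its support is covered by the support of [g] and
    one translate of it. *)
Lemma moves_commg f g x : moves [~ f, g] x -> moves g x \/ moves g (rho f x).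
Proof.
rewrite -invgR movesV commgEl => /moves_mul[|]; first by rewrite movesV; left.
by rewrite moves_conj; right.
Qed.

Hypothesis rho_inj : injective rho.
Hypothesis rho_rel : forall g, relaut (rho g).
Hypothesis dense : forall a b, a != b -> exists x, Cr X a x b.
(** A weak transitivity of the group of an arc on its subarcs. It provides nontrivial elements in
    every arc, and later forces the image of an arc to be connected. *)
Hypothesis mixing : forall a b a1 b1 a2 b2, a1 != b1 -> a2 != b2 ->
  (forall x, Cr X a1 x b1 -> Cr X a x b) ->
  (forall x, Cr X a2 x b2 -> Cr X a x b) ->
  exists g x, [/\ supported g a b, Cr X a1 x b1 & Cr X a2 (rho g x) b2].

Lemma moves_ex f : f != 1 -> exists x, moves f x.
Proof.
move=> f1; apply: contrapT => /forallNP nf; move/eqP: f1; apply.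
apply: rho_inj; apply: sym_ext => x; rewrite rho1.
by apply/eqP; apply: contrapT => /negP; exact: nf.
Qed.

Lemma moves_neq1 f x : moves f x -> f != 1.
Proof. by apply: contraTneq => ->; rewrite /moves rho1 eqxx. Qed.

Lemma disj_commute f g : disj f g -> commute f g.
Proof.
move=> fg; apply: rho_inj; apply: sym_ext => x; rewrite !rhoE.
have [fx|nfx] := boolP (moves f x).
  have gx := fg _ fx; rewrite moves_image in fx; have gfx := fg _ fx.
  by rewrite (movesPn _ _ gx) (movesPn _ _ gfx).
rewrite (movesPn _ _ nfx); have [gx|gx] := boolP (moves g x); last first.
  by rewrite (movesPn _ _ gx) (movesPn _ _ nfx).
have := gx; rewrite moves_image => /(disj_sym fg) nfgx.
by rewrite (movesPn _ _ nfgx).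
Qed.

Lemma open_moves f x : moves f x ->
  exists a b, [/\ Cr X a x b, forall y, Cr X a y b -> ~~ Cr X a (rho f y) b &
    forall y, Cr X a y b -> moves f y].
Proof.
move=> fx; have [a [b [axb ab]]] := wiggle dense (rho_rel f) fx.
exists a, b; split=> // y ayb; apply/negP => /eqP fy.
by have := ab _ ayb; rewrite fy ayb.
Qed.

Lemma locally_moving a b : a != b -> exists2 f, supported f a b & f != 1.
Proof.
move=> /dense[x axb]; have [ax xb _] := Cr_neq axb.
have [||g [y [gab ayx xgyb]]] := @mixing a b a x x b ax xb.
- by move=> y; move: axb; cyc [:: a; b; x; y].
- by move=> y; move: axb; cyc [:: a; b; x; y].
exists g => //; apply: (@moves_neq1 _ y); apply/eqP => gy.
by move: axb ayx xgyb; rewrite gy; cyc [:: a; b; x; y].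
Qed.

(** If [f] moves a small arc off itself and [g] is supported in that arc, then [f] carries the
    support of [g] to a disjoint set. *)
Lemma locally_noncommuting a b : a != b ->
  exists f g, [/\ supported f a b, supported g a b & ~ commute f g].
Proof.
move=> ab; have [f fab /moves_ex[x fx]] := locally_moving ab.
have [p [q [pxq nf pqf]]] := open_moves fx.
have [_ _ pq] := Cr_neq pxq.
have [g gpq /moves_ex[y gy]] := locally_moving pq.
exists f, g; split=> // [z /gpq/pqf/fab//|/(congr1 (fun h => rho h y))].
rewrite !rhoE => fg; have := nf _ (gpq _ gy); rewrite gpq //.
by rewrite /moves -fg (can_eq (rhoK f)).
Qed.

(** Since [f] and [h] do not commute, some small arc is moved by [f] everywhere and moved off itself
    by [h]. Two noncommuting elements of that arc serve as [f1] and [f2]: their supports lie in that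
    of [f], so they commute with [g]. *)
Lemma disj_alg_disjoint f g : disj f g -> alg_disjoint f g.
Proof.
move=> fg h nfh; have [x [fx hx]] : exists x, moves f x /\ moves h x.
  apply: contrapT => /forallNP nfx; apply: nfh; apply: disj_commute => x fx.
  by apply/negP => hx; apply: (nfx x).
have [a [b [axb _ abf]]] := open_moves fx.
have [a' [b' [a'xb' nh _]]] := open_moves hx.
have [p [q [pxq pqab]]] := arc_inter axb a'xb'.
have [_ _ pq] := Cr_neq pxq.
have [f1 [f2 [f1pq f2pq nf12]]] := locally_noncommuting pq.
have gpq y : Cr X p y q -> ~~ moves g y by move=> /pqab[/abf/fg].
have d1 : disj f1 g by move=> y /f1pq/gpq.
have d2 : disj f2 g by move=> y /f2pq/gpq.
have hpq y : Cr X p y q -> ~~ moves (f2 ^ h) y.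
  move=> pyq; rewrite moves_conj; apply/negP => /f2pq/pqab[_].
  by apply/negP/nh; case: (pqab _ pyq).
(* Here [[~ f2, h]] is [f2^-1 * f2 ^ h], and the second factor is supported away from the arc, so it
   commutes with [f1] and with [f2]. *)
have e : [~ f1, [~ f2, h]] = [~ f1, f2^-1].
  by rewrite commgEl; apply: commg_commuting; apply: disj_commute; apply: disj_sym;
    [move=> y /f1pq | move=> y; rewrite movesV => /f2pq]; exact: hpq.
have c1 := disj_commute d1; have c2 := disj_commute d2.
exists f1, f2; rewrite e; split=> //.
  apply/eqP => /eqP/commgP/commuteV; rewrite invgK; exact: nf12.
apply: commute_sym; rewrite /commg /conjg.
by repeat first [apply: commuteM | apply: commuteV]; apply: commute_sym.
Qed.

Lemma wiggle_seq x a b (s : seq G) : Cr X a x b -> {in s, forall g, moves g x} ->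
  exists p q, Cr X p x q /\
    {in s, forall g y, Cr X p y q -> ~~ Cr X p (rho g y) q}.
Proof.
move=> axb; elim: s => [|g s IHs] gs; first by exists a, b.
have [|p [q [pxq pq]]] := IHs; first by move=> h hs; apply: gs; rewrite inE hs orbT.
have [|a' [b' [axb' ab' _]]] := @open_moves g x; first by apply: gs; rewrite mem_head.
have [p' [q' [pxq' pq']]] := arc_inter pxq axb'.
exists p', q'; split=> // h; rewrite inE => /orP[/eqP->|hs] y /[dup] pyq' /pq'[py ay];
  apply/negP => /pq'[pgy agy].
- by have := ab' _ ay; rewrite agy.
- by have := pq _ hs _ py; rewrite pgy.
Qed.

Lemma movesX f n x : moves (f ^+ n) x -> moves f x.
Proof.
apply: contraTT => /movesPn fx; apply/movesPn.
by elim: n => [|n IHn]; rewrite ?rho1 // expgS rhoE IHn.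
Qed.

Lemma moves_commuteX f g n x : commute f g -> moves f x -> moves f (rho (g ^+ n) x).
Proof.
move=> fg fx; rewrite -moves_conj; suff -> : f ^ (g ^+ n) = f by [].
by apply/conjg_fixP/commgP/commuteX.
Qed.

(* The exponent 12 is the least common multiple of 1, 2, 3, 4: a point moved by
   g ^+ 12 has five distinct first iterates under g, one more than the number
   of translates of an arc needed to cover the support of a double commutator. *)
Lemma alg_disjoint_disj f g : alg_disjoint f g -> disj f (g ^+ 12).
Proof.
move=> fg x fx; apply/negP => g12x.
have [a [b [axb _ _]]] := open_moves fx.
have [|p [q [pxq pq]]] :=
    @wiggle_seq x a b [:: f; g ^+ 1; g ^+ 2; g ^+ 3; g ^+ 4] axb.
  move=> h; rewrite !inE => /or4P[/eqP->//| | |/orP[]] /eqP->.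
  - by apply: (@movesX _ 12); rewrite -expgnA.
  - by apply: (@movesX _ 6); rewrite -expgnA.
  - by apply: (@movesX _ 4); rewrite -expgnA.
  - by apply: (@movesX _ 3); rewrite -expgnA.
have gpq i y : 0 < i <= 4 -> Cr X p y q -> ~~ Cr X p (rho (g ^+ i) y) q.
  by case: i => [|[|[|[|[|//]]]]] // _; apply: pq; rewrite !inE eqxx ?orbT.
have [_ _ p_q] := Cr_neq pxq.
have [h hpq h1] := locally_moving p_q.
have [y hy] := moves_ex h1.
have [|f1 [f2 [c1 c2 /moves_ex[w kw] ck]]] := fg h.
  move=> /(congr1 (fun h => rho h y)); rewrite !rhoE => fh.
  have := pq f (mem_head _ _) _ (hpq _ hy).
  by rewrite hpq // /moves -fh (can_eq (rhoK f)).
(* Two uses of [moves_commg] cover the support of the double commutator by the preimages of the arc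
   under these four elements, all of which commute with [g]. *)
pose us (i : 'I_4) := nth 1 [:: 1; f2; f1; f2 * f1] i.
have usg i : commute (us i) g.
  case: i => [[|[|[|[|//]]]] ?] //=; rewrite /us /=.
    exact: commute_sym (commute1 _).
  by apply: commute_sym; apply: commuteM; apply: commute_sym.
have /(_ _)/cid-F (i : 'I_5) : exists j, Cr X p (rho (us j) (rho (g ^+ i) w)) q.
  have /moves_commg[|] := moves_commuteX i ck kw => /moves_commg[] /hpq.
  - by exists (@Ordinal 4 0 isT); rewrite /us rho1.
  - by exists (@Ordinal 4 1 isT).
  - by exists (@Ordinal 4 2 isT).
  - by exists (@Ordinal 4 3 isT); rewrite /us rhoE.
(* Pigeonhole: two of the five iterates of [w] are brought into the arc by the same element, so a
   power of [g] with exponent between 1 and 4 sends a point of the arc into the arc. *)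
have /injectivePn[i [j ij Fij]] : ~~ injectiveb (fun i => sval (F i)).
  by apply/injectiveP => /leq_card; rewrite !card_ord.
wlog lt_ij : i j ij Fij / i < j.
  move=> wl; case: (ltngtP i j) => [|ji|/val_inj eij]; first exact: wl.
    by apply: (wl j i) => //; rewrite eq_sym.
  by rewrite eij eqxx in ij.
have := svalP (F i); have := svalP (F j); rewrite -Fij.
have -> : rho (g ^+ j) w = rho (g ^+ (j - i)) (rho (g ^+ i) w).
  by rewrite -rhoE -expgnDr subnK // ltnW.
rewrite -rhoE (commuteX _ (usg _)) rhoE => + H.
apply/negP/gpq => //; have := ltn_ord j; lia.
Qed.

Lemma relaut_fix3 (f : X -> X) x y z : relaut f -> Cr X x y z ->
  f x = x -> f y = y -> f z = z -> preserving (Cr X) f.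
Proof.
case=> // rf xyz fx fy fz; have := rf x y z.
by rewrite fx fy fz xyz (negbTE (Cr_anti xyz)).
Qed.

Lemma supported_fixed f a b x : supported f a b -> ~~ Cr X a x b -> rho f x = x.
Proof. by move=> fab; apply: contraNeq => /fab. Qed.

Lemma supported_preserving f a b : a != b -> supported f a b -> preserving (Cr X) (rho f).
Proof.
move=> /[dup] ab; rewrite eq_sym => /dense[z bza] fab.
apply: (relaut_fix3 (rho_rel f) bza); apply: (supported_fixed fab) => //;
  by move: bza; cyc [:: a; b; z].
Qed.

(** The element [f] preserves orientation and fixes [a], so it is increasing on the circle opened at
    [a] and the orbit of [x] is strictly monotone. *)
Lemma supported_movesX f a b n x : a != b -> supported f a b -> moves f x ->
  moves (f ^+ n.+1) x.
Proof.
move=> ab fab fx; have pf := supported_preserving ab fab.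
have fa : rho f a = a by apply: (supported_fixed fab); cyc [:: a; b].
have fX m : rho f (rho (f ^+ m) x) = rho (f ^+ m.+1) x by rewrite expgS rhoE.
have ax : a != x by move: (fab _ fx); cyc [:: a; b; x].
have afx : a != rho f x by rewrite -{1}fa (can_eq (rhoK f)).
have xfx : x != rho f x by rewrite eq_sym.
have [] := orP (Cr_total ax xfx afx) => axfx.
- suff : Cr X a x (rho (f ^+ n.+1) x) by rewrite /moves; cyc [:: a; x; rho (f ^+ n.+1) x].
  elim: n => [|n IHn]; first by rewrite expg1.
  have := pf a x (rho (f ^+ n.+1) x); rewrite IHn fX fa; move: axfx.
  cyc [:: a; x; rho f x; rho (f ^+ n.+2) x].
- suff : Cr X (rho (f ^+ n.+1) x) x a by rewrite /moves; cyc [:: a; x; rho (f ^+ n.+1) x].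
  elim: n => [|n IHn]; first by rewrite expg1.
  have := pf (rho (f ^+ n.+1) x) x a; rewrite IHn fX fa; move: axfx.
  cyc [:: a; x; rho f x; rho (f ^+ n.+2) x].
Qed.

(** If [u] moved a point outside the closure of the support of [f], some small arc would be disjoint
    from that support and moved off itself by [u]. A nontrivial [g] in this arc is disjoint from
    [f], yet [u] cannot commute with [g ^+ 12], whose support is nonempty by [supported_movesX]. *)
Lemma alg_supportP f u : alg_support f u <->
  forall x a b, moves u x -> Cr X a x b -> exists y, Cr X a y b /\ moves f y.
Proof.
split=> [fu x a b ux axb|fu g /alg_disjoint_disj fg]; last first.
  apply: disj_commute => x ux; apply/negP => gx.
  have [a [b [axb _ abg]]] := open_moves gx.
  have [y [ayb fy]] := fu _ _ _ ux axb.
  by have := fg _ fy; rewrite abg.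
apply: contrapT => /forallNP nf.
have [c [e [cxe ce _]]] := open_moves ux.
have [p [q [pxq pq]]] := arc_inter axb cxe.
have [_ _ p_q] := Cr_neq pxq.
have [g gpq /moves_ex[y gy]] := locally_moving p_q.
have /disj_alg_disjoint/fu gu : disj f g.
  by move=> z fz; apply/negP => /gpq/pq[azb _]; apply: (nf z).
have gX := supported_movesX 11 p_q gpq gy.
have := moves_commuteX 1 (commute_sym gu) gX; rewrite expg1 => /movesX/gpq/pq[_].
by apply/negP/ce; case: (pq y (gpq _ gy)).
Qed.

(** A nontrivial [u] has nonempty open support; inside the closures of two open sets it meets the
    first in an open set, which then meets the second. *)
Lemma disj_alg_support f g : disj f g <->
  forall u, alg_support f u -> alg_support g u -> u = 1.
Proof.
split=> [fg u /alg_supportP fu /alg_supportP gu|fg x fx].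
  apply/eqP; apply: contrapT => /negP/moves_ex[x ux].
  have [a [b [axb _ abu]]] := open_moves ux.
  have [y [ayb fy]] := fu _ _ _ ux axb.
  have [a' [b' [ayb' _ abf]]] := open_moves fy.
  have [p [q [pyq pq]]] := arc_inter ayb ayb'.
  have [|z [/pq[_ /abf fz] gz]] := gu y p q _ pyq; first exact: abu.
  by have := fg _ fz; rewrite gz.
apply/negP => gx; have [a [b [axb _ abf]]] := open_moves fx.
have [a' [b' [axb' _ abg]]] := open_moves gx.
have [p [q [pxq pq]]] := arc_inter axb axb'.
have [_ _ p_q] := Cr_neq pxq.
have [u upq] := locally_moving p_q; move/eqP; apply; apply: fg.
- by apply/alg_supportP => y c e uy cye; exists y; split=> //; case/upq/pq: uy => /abf.
- by apply/alg_supportP => y c e uy cye; exists y; split=> //; case/upq/pq: uy => _ /abg.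
Qed.

(** Even when [x] is the endpoint [a] or [b], the arc around it reaches into the open complementary
    arc. *)
Lemma arc_meet a b c e x : a != b -> Cr X c x e -> ~~ Cr X a x b ->
  exists p q, p != q /\ forall y, Cr X p y q -> Cr X c y e /\ Cr X b y a.
Proof.
move=> ab cxe naxb.
have [z [cze bza]] : exists z, Cr X c z e /\ Cr X b z a.
  have [xa|xa] := eqVneq x a.
    rewrite xa in cxe; have [|z] := @dense (if Cr X b c a then c else b) a.
      by case: ifP; move: cxe ab; cyc [:: a; b; c; e].
    by case: ifP => h za; exists z; split; move: h za cxe ab; cyc [:: a; b; c; e; z].
  have [xb|xb] := eqVneq x b.
    rewrite xb in cxe; have [|z] := @dense b (if Cr X b e a then e else a).
      by case: ifP; move: cxe ab; cyc [:: a; b; c; e].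
    by case: ifP => h bz; exists z; split; move: h bz cxe ab; cyc [:: a; b; c; e; z].
  by exists x; split=> //; move: ab naxb xa xb; cyc [:: a; b; x].
have [p [q [pzq pq]]] := arc_inter cze bza.
by exists p, q; have [_ _ ->] := Cr_neq pzq.
Qed.

(** Expresses the group of an arc by disjointness from the group of the opposite arc. The endpoints
    cause no trouble because supports are open. *)
Lemma supportedP f a b : a != b ->
  supported f a b <-> forall g, supported g b a -> disj f g.
Proof.
move=> ab; split=> [fab g gba x /fab axb|fg x fx].
  by apply/negP => /gba; move: axb; cyc [:: a; b; x].
apply: contrapT => /negP naxb.
have [c [e [cxe _ cef]]] := open_moves fx.
have [p [q [p_q pq]]] := arc_meet ab cxe naxb.
have [g gpq /moves_ex[y gy]] := locally_moving p_q.
have /fg/disj_sym/(_ y gy) : supported g b a by move=> z /gpq/pq[].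
by case/negP; case/gpq/pq: gy => /cef.
Qed.

Lemma disj_arcs a b c e : (forall f g, supported f a b -> supported g c e -> disj f g) ->
  forall x, Cr X a x b -> ~~ Cr X c x e.
Proof.
move=> fg x axb; apply/negP => cxe.
have [p [q [pxq pq]]] := arc_inter axb cxe.
have [_ _ p_q] := Cr_neq pxq.
have [h hpq /moves_ex[y hy]] := locally_moving p_q.
have hab : supported h a b by move=> z /hpq/pq[].
have hce : supported h c e by move=> z /hpq/pq[].
by have := fg _ _ hab hce y hy; rewrite hy.
Qed.

Lemma supported_sub a b c e : c != e ->
  (forall f, supported f a b -> supported f c e) -> forall x, Cr X a x b -> Cr X c x e.
Proof.
move=> ce sub x axb; apply: contrapT => /negP ncxe.
have [p [q [p_q pq]]] := arc_meet ce axb ncxe.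
have [h hpq /moves_ex[y hy]] := locally_moving p_q.
have hab : supported h a b by move=> z /hpq/pq[].
have := sub _ hab _ hy; case/hpq/pq: hy => _; cyc [:: c; e; y].
Qed.

Lemma arc_inj a b c e : a != b -> c != e ->
  (forall x, Cr X a x b = Cr X c x e) -> a = c /\ b = e.
Proof.
move=> ab ce ac; suff /andP[/eqP-> /eqP->] : (a == c) && (b == e) by [].
have [x axb] := dense ab; have cxe : Cr X c x e by rewrite -ac.
have na : ~~ Cr X c a e by rewrite -ac; cyc [:: a; b].
have nb : ~~ Cr X c b e by rewrite -ac; cyc [:: a; b].
have nc : ~~ Cr X a c b by rewrite ac; cyc [:: c; e].
have ne : ~~ Cr X a e b by rewrite ac; cyc [:: c; e].
by move: ab ce axb cxe na nb nc ne; cyc [:: a; b; c; e; x].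
Qed.

Hypothesis fill : @arc_complete d X.

Lemma disjM (phi psi : UMagmaMorphism.type G G) (phiK : cancel phi psi)
    (psiK : cancel psi phi) f g :
  disj f g -> disj (phi f) (phi g).
Proof.
move=> /disj_alg_support fg; apply/disj_alg_support => u fu gu.
apply: (can_inj psiK); rewrite gmulf1; apply: fg.
  by rewrite -[f]phiK; exact: alg_supportM fu.
by rewrite -[g]phiK; exact: alg_supportM gu.
Qed.

Definition arc_image (phi : G -> G) a b a' b' := [/\ a != b, a' != b' &
  forall f, supported f a b <-> supported (phi f) a' b'].

(** * Recovering the points of the circle *)

Section Transfer.
Variables phi psi : UMagmaMorphism.type G G.
Hypotheses (phiK : cancel phi psi) (psiK : cancel psi phi).

(** By [supportedP] the group of the arc is determined by the elements disjoint from the opposite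
    one, a condition that [phi] preserves. So [U] is the interior of the complement of the supports
    of the images of the opposite group. *)
Lemma arc_image_open a b : a != b -> exists U : set X,
  [/\ arc_open U, U !=set0,
    forall f, supported f a b <-> forall x, moves (phi f) x -> U x &
    exists c e, c != e /\ forall x, Cr X c x e -> ~ U x].
Proof.
move=> ab; pose W x := exists2 g, supported g b a & moves (phi g) x.
pose U : set X := [set x | exists p q, Cr X p x q /\ forall y, Cr X p y q -> ~ W y].
have UE f : supported f a b <-> forall x, moves (phi f) x -> U x.
  rewrite supportedP //; split=> [fd x fx|fU g gba].
    have [p [q [pxq _ pq]]] := open_moves fx; exists p, q; split=> // y /pq fy [g gba gy].
    by have := disjM phiK psiK (fd _ gba) fy; rewrite gy.
  rewrite -[f]phiK -[g]phiK; apply: (disjM psiK phiK) => x fx; apply/negP => gx.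
  by have [p [q [pxq]]] := fU _ fx; move/(_ x pxq); apply; exists g.
have phi1 f : f != 1 -> exists x, moves (phi f) x.
  by move=> f1; apply: moves_ex; rewrite gmulf_eq1 //; exact: can_inj phiK.
exists U; split=> //.
- by move=> x [p [q [pxq pq]]]; exists p, q; split=> // y pyq; exists p, q.
- have [f fab /phi1[x fx]] := locally_moving ab.
  by exists x; move: x fx; apply/UE.
- have [|g gba /phi1[x gx]] := @locally_moving b a; first by rewrite eq_sym.
  have [c [e [cxe _ ce]]] := open_moves gx; exists c, e.
  have [_ _ ->] := Cr_neq cxe; split=> // y /ce gy [p [q [pyq]]].
  by move/(_ y pyq); apply; exists g.
Qed.

(** Suppose [U] had a point outside a component [(a', b')]. Take [f1] supported in the component and
    [f2] supported in [U] outside it. By [mixing], some [g] in the source group carries a point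
    moved by [psi f1] to one moved by [psi f2]. But [phi g] fixes [a'] and [b'] and preserves the
    component, so it cannot make the supports of [f1] and [f2] meet. *)
Lemma arc_image_ex a b : a != b -> exists a' b', arc_image phi a b a' b'.
Proof.
move=> ab; have [U [oU [x Ux] UE [c [e [ce ceU]]]]] := arc_image_open ab.
have [y cye] := dense ce; have [cy ye _] := Cr_neq cye.
have [z czy] := dense cy; have [cz zy _] := Cr_neq czy.
have nUy : ~ U y by exact: ceU.
have nUz : ~ U z by apply: ceU; move: cye czy; cyc [:: c; e; y; z].
have [a' [b' [axb abU nUa nUb]]] := component dense fill oU Ux nUz nUy zy.
have [_ _ ab'] := Cr_neq axb; exists a', b'; split=> // f.
suff Uab w : U w -> Cr X a' w b'.
  by rewrite UE; split=> [fU w /fU/Uab|fab w /fab/abU].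
move=> {f} Uw; apply: contrapT => /negP nw.
have [c' [e' [cwe' ce'U]]] := oU _ Uw.
have [p [q [pq pqU]]] := arc_meet ab' cwe' nw.
have [f1 f1ab /moves_ex[x1 fx1]] := locally_moving ab'.
have [f2 f2pq /moves_ex[x2 fx2]] := locally_moving pq.
have sub f : (forall x, moves f x -> U x) -> supported (psi f) a b.
  by move=> fU; apply/UE; rewrite psiK.
have f1U : supported (psi f1) a b by apply: sub => v /f1ab/abU.
have f2U : supported (psi f2) a b by apply: sub => v /f2pq/pqU[/ce'U].
have psi1 f t : moves f t -> exists s, moves (psi f) s.
  by move=> /moves_neq1 ?; apply: moves_ex; rewrite gmulf_eq1 //; exact: can_inj psiK.
have [y1 /open_moves[a1 [b1 [/Cr_neq[_ _ ab1] _ m1]]]] := psi1 _ _ fx1.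
have [y2 /open_moves[a2 [b2 [/Cr_neq[_ _ ab2] _ m2]]]] := psi1 _ _ fx2.
have [||g [v [/UE gU v1 v2]]] := @mixing a b _ _ _ _ ab1 ab2.
- by move=> v /m1/f1U.
- by move=> v /m2/f2U.
suff dis : disj f1 (f2 ^ phi g).
  have := disjM psiK phiK dis (m1 _ v1).
  by rewrite gmulfJ phiK moves_conj m2.
have fix_g t : ~ U t -> rho (phi g) t = t.
  by move=> nUt; apply/movesPn/negP => /gU.
(* A third fixed point rules out that [phi g] reverses the circle, exchanging the two arcs between
   [a'] and [b']. *)
have [t [bta nUt]] : exists t, Cr X b' t a' /\ ~ U t.
  suff [t [cte ta tb]] : exists t, [/\ Cr X c t e, t != a' & t != b'].
    exists t; split; last exact: ceU.
    have : ~~ Cr X a' t b' by apply/negP => /abU; exact: ceU.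
    by move: ta tb ab'; cyc [:: a'; b'; t].
  have [c1 [e1 [ce1 ce1P]]] := arc_avoid dense a' ce.
  have [c2 [e2 [ce2 ce2P]]] := arc_avoid dense b' ce1.
  have [t /ce2P/andP[/ce1P/andP[cte ta] tb]] := dense ce2.
  by exists t.
have pg : preserving (Cr X) (rho (phi g)).
  by apply: (relaut_fix3 (rho_rel _) bta); exact: fix_g.
move=> v' /f1ab av'b; rewrite moves_conj; apply/negP => /f2pq/pqU[_].
have := pg a' v' b'; rewrite (fix_g _ nUa) (fix_g _ nUb) av'b.
by cyc [:: a'; b'; rho (phi g) v'].
Qed.

Lemma arc_imageC a b a' b' : arc_image phi a b a' b' -> arc_image phi b a b' a'.
Proof.
move=> [ab ab' im].
have ba : b != a by rewrite eq_sym.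
have ba' : b' != a' by rewrite eq_sym.
split=> // f; rewrite !supportedP //; split=> fd g.
  by rewrite -[g]psiK => /im/fd; exact: disjM.
move=> /im/fd; rewrite -[X in _ -> disj X _]phiK -[X in _ -> disj _ X]phiK.
exact: disjM.
Qed.

Lemma arc_imageV a b a' b' : arc_image phi a b a' b' -> arc_image psi a' b' a b.
Proof. by move=> [ab ab' im]; split=> // f; rewrite im psiK. Qed.

Lemma arc_image_fun a b c e c' e' : 
  arc_image phi a b c e -> arc_image phi a b c' e' -> c = c' /\ e = e'.
Proof.
move=> [ab ce im] [_ ce' im']; apply: arc_inj => // x.
by apply/idP/idP; apply: supported_sub => // f; rewrite -[f]psiK -im -im'.
Qed.

Lemma arc_image_disj p q r s a b c e :
  arc_image phi p q a b -> arc_image phi r s c e ->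
  (forall x, Cr X p x q -> ~~ Cr X r x s) -> forall x, Cr X a x b -> ~~ Cr X c x e.
Proof.
move=> [_ _ im] [_ _ im'] pqrs; apply: disj_arcs => f g.
rewrite -[f]psiK -[g]psiK -im -im' => fpq grs; apply: disjM => // x /fpq/pqrs.
by apply: contra => /grs.
Qed.

(** The arcs between consecutive vertices are disjoint with dense union; both properties are
    inherited by their images, to which [three_arcs] applies. *)
Lemma arc_image_triangle p q r a b : Cr X p q r -> arc_image phi p q a b ->
  exists c, Cr X a b c /\
   (arc_image phi q r b c /\ arc_image phi r p c a \/
    arc_image phi q r c a /\ arc_image phi r p b c).
Proof.
move=> pqr im1; have [pq qr pr] := Cr_neq pqr.
have rp : r != p by rewrite eq_sym.
have [c [e im2]] := arc_image_ex qr; have [u [v im3]] := arc_image_ex rp.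
have d1 := arc_image_disj im1 im2; have d2 := arc_image_disj im1 im3.
have d3 := arc_image_disj im2 im3.
have [_ ab i1] := im1; have [_ ce i2] := im2; have [_ uv i3] := im3.
have [] := @three_arcs _ _ dense a b c e u v ab ce uv.
- by apply: d1 => x; move: pqr; cyc [:: p; q; r; x].
- by apply: d2 => x; move: pqr; cyc [:: p; q; r; x].
- by apply: d3 => x; move: pqr; cyc [:: p; q; r; x].
(* Density: if [h] were supported off the three images, [psi h] would move a point other than [p],
   [q], [r], lying in one of the three source arcs. *)
- move=> s t st; apply: contrapT => /forallNP nst.
  have [h hst h1] := locally_moving st.
  have [y hy] : exists y, moves (psi h) y.
    by apply: moves_ex; rewrite gmulf_eq1 //; exact: can_inj psiK.
  have [s' [t' [/Cr_neq[_ _ st'] _ hst']]] := open_moves hy.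
  have [s1 [t1 [st1 P1]]] := arc_avoid dense p st'.
  have [s2 [t2 [st2 P2]]] := arc_avoid dense q st1.
  have [s3 [t3 [st3 P3]]] := arc_avoid dense r st2.
  have [z szt] := dense st3.
  have /andP[/P2/andP[/P1/andP[sz zp] zq] zr] := P3 _ szt.
  have {}hst' z' : Cr X s3 z' t3 -> moves (psi h) z'.
    by move=> /P3/andP[/P2/andP[/P1/andP[/hst']]].
  have no p' q' a' b' : (forall f, supported f p' q' <-> supported (phi f) a' b') ->
      (forall x, Cr X s x t -> ~~ Cr X a' x b') -> ~~ Cr X p' z q'.
    move=> i dis; apply/negP => pzq.
    have [k [l [kzl kl]]] := arc_inter szt pzq; have [_ _ k_l] := Cr_neq kzl.
    have [f fkl /moves_ex[w fw]] := locally_moving k_l.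
    have /i fpq : supported f p' q' by move=> ? /fkl/kl[].
    have hf : disj h (phi f) by move=> ? /hst/dis; apply: contra => /fpq.
    have := disjM psiK phiK hf; rewrite phiK => /(_ w).
    rewrite fw => /(_ _)/negP; apply => //.
    by apply: hst'; case/fkl/kl: fw.
  have n x : Cr X s x t -> ~~ [|| Cr X a x b, Cr X c x e | Cr X u x v].
    by move=> sxt; apply/negP => h'; apply: (nst x).
  have n1 : ~~ Cr X p z q by apply: no i1 _ => x /n; rewrite !negb_or => /and3P[].
  have n2 : ~~ Cr X q z r by apply: no i2 _ => x /n; rewrite !negb_or => /and3P[].
  have n3 : ~~ Cr X r z p by apply: no i3 _ => x /n; rewrite !negb_or => /and3P[].
  by move: pqr zp zq zr n1 n2 n3; cyc [:: p; q; r; z].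
- by move=> [? ? ? abe]; subst c u v; exists e; split=> //; left.
- by move=> [? ? ? abv]; subst u c e; exists v; split=> //; right.
Qed.

(** The order of the images is left open because [phi] may correspond to a reversal; an arc and its
    complement give the same pairs by [arc_imageC]. *)
Definition pair_image p q s t := arc_image phi p q s t \/ arc_image phi p q t s.

Lemma pair_imageC p q s t : pair_image p q s t -> pair_image q p s t.
Proof. by case=> /arc_imageC im; [right|left]. Qed.

Lemma pair_image_swap p q s t : pair_image p q s t -> pair_image p q t s.
Proof. by case=> im; [right|left]. Qed.

Lemma pair_image_fun p q s t s' t' : pair_image p q s t -> pair_image p q s' t' ->
  s = s' /\ t = t' \/ s = t' /\ t = s'.
Proof.
by case=> im [] im'; have [-> ->] := arc_image_fun im im'; auto.
Qed.

Lemma arc_image_inj p q p' q' a b :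
  arc_image phi p q a b -> arc_image phi p' q' a b -> p = p' /\ q = q'.
Proof.
move=> [pq ab im] [pq' _ im']; apply: arc_inj => // x.
by apply/idP/idP; apply: supported_sub => // f; rewrite im im'.
Qed.

Lemma pair_image_inj p q p' q' s t : pair_image p q s t -> pair_image p' q' s t ->
  p = p' /\ q = q' \/ p = q' /\ q = p'.
Proof.
case=> im [] im'; first by left; exact: arc_image_inj im im'.
- by right; apply: arc_image_inj im _; exact: arc_imageC.
- by right; apply: arc_image_inj im _; exact: arc_imageC.
- by left; exact: arc_image_inj im im'.
Qed.

Lemma triangle_image p q r : p != q -> q != r -> p != r ->
  exists t s1 s2, [/\ s1 != s2, pair_image p q t s1, pair_image p r t s2 & pair_image q r s1 s2].
Proof.
move=> pq qr pr; wlog pqr : q r pq qr pr / Cr X p q r => [wl|].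
  have /orP[|rqp] := Cr_total pq qr pr; first exact: wl.
  have [||t [s1 [s2 [s12 im1 im2 im3]]]] := wl r q pr _ pq; rewrite 1?eq_sym //.
    by rewrite CrC.
  exists t, s2, s1; rewrite eq_sym; split=> //.
  exact/pair_imageC/pair_image_swap.
have [a [b im]] := arc_image_ex pq.
have [c [/Cr_neq[ab bc ac] [[im1 im2]|[im1 im2]]]] := arc_image_triangle pqr im.
- exists a, b, c; split; [by []|by left| |by left].
  by apply/pair_imageC; right.
- exists b, a, c; split; [by []|by right| |by right].
  by apply/pair_imageC; left.
Qed.

(* Two images of pairs through [p] meet; three of them without a common point
   would be the sides of a triangle, one side of which is already the image of a
   pair avoiding [p]. *)
Lemma tau_ex p : (exists q, q != p) ->
  exists t, forall q, p != q -> exists s, pair_image p q t s.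
Proof.
move=> [q]; rewrite eq_sym => pq; have [r pqr] := dense pq.
have [] := Cr_neq pqr => pr rq _; have qr : q != r by rewrite eq_sym.
have [t [s1 [s2 [s12 im1 im2 im3]]]] := triangle_image pq qr pr.
exists t => w pw.
have [<-|qw] := eqVneq q w; first by exists s1.
have [<-|rw] := eqVneq r w; first by exists s2.
have [t1 [x1 [x2 [x12 im4 im5 _]]]] := triangle_image pq qw pw.
have [t2 [y1 [y2 [y12 im6 im7 _]]]] := triangle_image pr rw pw.
have [[tt1 _]|[tx1 s1t1]] := pair_image_fun im1 im4; first by exists x2; rewrite tt1.
have [[tt2 _]|[ty1 s2t2]] := pair_image_fun im2 im6; first by exists y2; rewrite tt2; exact: im7.
have [[t12 _]|[_ x2t2]] := pair_image_fun im5 im7.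
  by rewrite s1t1 s2t2 t12 eqxx in s12.
have im8 : pair_image p w s1 s2 by rewrite s1t1 s2t2 -x2t2.
by case: (pair_image_inj im8 im3) => -[e _]; move: pq pr; rewrite e eqxx.
Qed.

Hypothesis two_points : exists a b : X, a != b.

Lemma other_point p : exists q, p != q.
Proof.
have [a [b ab]] := two_points; have [<-|pa] := eqVneq a p; first by exists b.
by exists a; rewrite eq_sym.
Qed.

(** One pair through [p] does not tell which of the two image points belongs to [p]. A second pair,
    through a third point [r], decides it; the same test is made at [q]. *)
Lemma tau_exists : exists tau : X -> X, forall p q, p != q ->
  tau p != tau q /\ pair_image p q (tau p) (tau q).
Proof.
have /choice[tau tauP] : forall p, exists t, forall q, p != q -> exists s, pair_image p q t s.
  by move=> p; apply: tau_ex; have [q] := other_point p; rewrite eq_sym; exists q.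
exists tau => p q pq; have [r pqr] := dense pq.
have [] := Cr_neq pqr => pr rq _; have qr : q != r by rewrite eq_sym.
have qp : q != p by rewrite eq_sym.
have [t [s1 [s2 [s12 im1 im2 im3]]]] := triangle_image pq qr pr.
have [x imx] := tauP _ _ pq; have [y imy] := tauP _ _ pr.
have [z imz] := tauP _ _ qp; have [w imw] := tauP _ _ qr.
have im1' := pair_imageC im1.
have ets : t != s1.
  by case: im1 => -[_ + _]; rewrite // eq_sym.
have ep : tau p = t.
  have [[]//|[e1 _]] := pair_image_fun imx im1.
  have [[]//|[e2 _]] := pair_image_fun imy im2.
  by rewrite -e1 -e2 eqxx in s12.
have eq : tau q = s1.
  have [[e1 _]|[]//] := pair_image_fun imz im1'.
  have [[]//|[e2 _]] := pair_image_fun imw im3.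
  have ets2 : t != s2 by case: im2 => -[_ + _]; rewrite // eq_sym.
  by rewrite -e1 -e2 eqxx in ets2.
by rewrite ep eq.
Qed.

Variable tau : X -> X.
Hypothesis tauP : forall p q, p != q ->
  tau p != tau q /\ pair_image p q (tau p) (tau q).

Definition positive p q := arc_image phi p q (tau p) (tau q).

Lemma positiveC p q : positive p q <-> positive q p.
Proof. by split; exact: arc_imageC. Qed.

Lemma negative_image p q : p != q -> ~ positive p q -> arc_image phi p q (tau q) (tau p).
Proof. by move=> /tauP[_ []]. Qed.

(** Of the two triangles offered by [arc_image_triangle], injectivity of [tau] excludes the one that
    does not match the pair of [tau q] and [tau r]; the other fixes both the sign and the
    orientation of the image triple. *)
Lemma positive_next p q r : Cr X p q r ->
  (positive p q -> positive q r /\ Cr X (tau p) (tau q) (tau r)) /\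
  (~ positive p q -> ~ positive q r /\ Cr X (tau r) (tau q) (tau p)).
Proof.
move=> pqr; have [pq qr pr] := Cr_neq pqr.
have [tpq _] := tauP pq; have [tqr imqr] := tauP qr; have [tpr _] := tauP pr.
split=> [pos|/(negative_image pq) neg].
  have [c [abc [[im1 _]|[im1 _]]]] := arc_image_triangle pqr pos.
    have [[_ e]|[e _]] := pair_image_fun imqr (or_introl im1).
      by rewrite e; split=> //; rewrite /positive e.
    by rewrite e in abc; have [_] := Cr_neq abc; rewrite e eqxx.
  have [[_ e]|[e _]] := pair_image_fun imqr (or_introl im1).
    by rewrite e eqxx in tpr.
  by rewrite e eqxx in tpq.
have [c [abc [[im1 _]|[im1 _]]]] := arc_image_triangle pqr neg.
  have [[e _]|[_ e]] := pair_image_fun imqr (or_introl im1).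
    by rewrite e eqxx in tpq.
  by rewrite e eqxx in tpr.
have [[_ e]|[_ e]] := pair_image_fun imqr (or_introl im1).
  by rewrite e eqxx in tqr.
split=> [pos|]; last by rewrite e CrC.
have [e' _] := arc_image_fun pos im1.
by rewrite e e' eqxx in tqr.
Qed.
Lemma positive_step p q r : p != q -> q != r -> p != r -> positive p q -> positive q r.
Proof.
move=> pq qr pr pos; have /orP[pqr|rqp] := Cr_total pq qr pr.
  by have [h _] := positive_next pqr; case: (h pos).
apply: contrapT => neg; have [_ h] := positive_next rqp.
have [|npos _] := h; first by move=> /positiveC.
by apply: npos; apply/positiveC.
Qed.

Lemma fresh_point (s : seq X) : exists x, x \notin s.
Proof.
have [a [b ab]] := two_points.
suff [c [e [/dense[x cxe] ce]]] : exists c e, c != e /\ forall x, Cr X c x e -> x \notin s.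
  by exists x; exact: ce.
elim: s => [|y s [c [e [ce ces]]]]; first by exists a, b.
have [c' [e' [ce' ceP]]] := arc_avoid dense y ce.
exists c', e'; split=> // x /ceP/andP[/ces xs xy].
by rewrite inE negb_or xy.
Qed.

(** The sign is carried along the path [p], [q], [s], [t], [p'], [q']. Two fresh points are inserted
    because [positive_step] needs any three successive points to be distinct, while the given pairs
    may overlap. *)
Lemma positive_const p q p' q' : p != q -> p' != q' -> positive p q -> positive p' q'.
Proof.
move=> pq pq' pos; have [s] := fresh_point [:: p; q; p'; q'].
have [t] := fresh_point [:: s; p; q; p'; q'].
rewrite !inE !negb_or => /and5P[ts tp tq tp' tq'] /and4P[sp sq sp' sq'].
have st : s != t by rewrite eq_sym.
have ps : p != s by rewrite eq_sym.
have qs : q != s by rewrite eq_sym.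
have qt : q != t by rewrite eq_sym.
have /(positive_step qs st qt)/(positive_step st tp' sp') := positive_step pq qs ps pos.
exact: positive_step.
Qed.

Lemma tau_relaut : relaut tau.
Proof.
have [[p [q [pq pos]]]|neg] := pselect (exists p q, p != q /\ positive p q).
  left; apply: Cr_homo => x y z xyz; have [xy _ _] := Cr_neq xyz.
  by have [+ _] := positive_next xyz => /(_ (positive_const pq xy pos))[].
right; apply: Cr_anti_homo => x y z xyz; have [xy _ _] := Cr_neq xyz.
have [_ h] := positive_next xyz; case: h => // pos.
by apply: neg; exists x, y.
Qed.

Lemma conj_supported g a b : exists a' b',
  (a' = rho g a /\ b' = rho g b \/ a' = rho g b /\ b' = rho g a) /\
  forall f, supported f a b <-> supported (f ^ g^-1) a' b'.
Proof.
case: (rho_rel g) => rg; [exists (rho g a), (rho g b)|exists (rho g b), (rho g a)];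
  (split; first by auto) => f; split=> fab x.
- by rewrite moves_conj => /fab; rewrite -rg rhoKV.
- by rewrite -[x](rhoK g) -moves_conj => /fab; rewrite rg rhoK.
- by rewrite moves_conj => /fab; rewrite -rg rhoKV.
- by rewrite -[x](rhoK g) -moves_conj => /fab; rewrite rg rhoK.
Qed.

Lemma pair_image_conj g p q s t : pair_image p q s t ->
  pair_image (rho g p) (rho g q) (rho (phi g) s) (rho (phi g) t).
Proof.
wlog im : s t / arc_image phi p q s t => [wl|_].
  case=> im; first by apply: wl => //; left.
  by apply: pair_image_swap; apply: wl => //; left.
have [pq st i] := im.
have [p' [q' [epq gpq]]] := conj_supported g p q.
have [s' [t' [est gst]]] := conj_supported (phi g) s t.
have im' : arc_image phi p' q' s' t'.
  split=> [||f].
  - by case: epq => -[-> ->]; rewrite (can_eq (rhoK g)) // eq_sym.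
  - by case: est => -[-> ->]; rewrite (can_eq (rhoK (phi g))) // eq_sym.
  have := gpq (f ^ g); rewrite -conjgM mulgV conjg1 => <-; rewrite i gst.
  by rewrite gmulfJ -conjgM mulgV conjg1.
case: epq est im' => -[-> ->] [] [-> ->] im'.
- by left.
- by right.
- by apply: pair_imageC; left.
- by apply: pair_imageC; right.
Qed.

(** Both sides are common points of the images of all pairs through [rho g p]; two such pairs leave
    a single candidate. *)
Lemma tau_conj g p : rho (phi g) (tau p) = tau (rho g p).
Proof.
have [q pq] := other_point p; have [r pqr] := dense pq.
have [pr rq _] := Cr_neq pqr.
have key w : p != w -> tau (rho g p) = rho (phi g) (tau p) \/ tau (rho g p) = rho (phi g) (tau w).
  move=> pw; have [_ /(pair_image_conj g) im] := tauP pw.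
  have [|_ im'] := @tauP (rho g p) (rho g w); first by rewrite (can_eq (rhoK g)).
  by case: (pair_image_fun im' im) => -[]; auto.
have [//|e1] := key _ pq; have [//|e2] := key _ pr.
have := tauP rq; rewrite -(can_eq (rhoK (phi g))) -e1 -e2 eqxx.
by case.
Qed.

End Transfer.

Lemma pair_imageV (phi psi : UMagmaMorphism.type G G) (phiK : cancel phi psi)
    (psiK : cancel psi phi) p q s t :
  pair_image phi p q s t -> pair_image psi s t p q.
Proof.
case=> /(arc_imageV psiK) im; first by left.
by right; apply: arc_imageC im.
Qed.

Lemma tau_cancel (phi psi : UMagmaMorphism.type G G) (phiK : cancel phi psi)
    (psiK : cancel psi phi) (two_points : exists a b : X, a != b) (tau tau' : X -> X) :
  (forall p q, p != q -> tau p != tau q /\ pair_image phi p q (tau p) (tau q)) ->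
  (forall p q, p != q -> tau' p != tau' q /\ pair_image psi p q (tau' p) (tau' q)) ->
  cancel tau tau'.
Proof.
move=> tauP tauP' p.
have [q pq] := other_point two_points p; have [r pqr] := dense pq.
have [pr rq _] := Cr_neq pqr.
have key w : p != w -> tau' (tau p) = p \/ tau' (tau p) = w.
  move=> /tauP[/tauP'[_ im] /(pair_imageV phiK psiK) im'].
  by case: (pair_image_fun phiK im im') => -[]; auto.
have [//|e1] := key _ pq; have [//|e2] := key _ pr.
by rewrite -e1 -e2 eqxx in rq.
Qed.

Theorem reconstruction (two_points : exists a b : X, a != b)
    (phi psi : UMagmaMorphism.type G G) (phiK : cancel phi psi)
    (psiK : cancel psi phi) :
  exists tau : sym X, relaut tau /\ forall g, rho (phi g) = tau * rho g * tau^-1.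
Proof.
have [tau tauP] := tau_exists phiK psiK two_points.
have [tau' tauP'] := tau_exists psiK phiK two_points.
exists (Sym (tau_cancel phiK psiK two_points tauP tauP')
            (tau_cancel psiK phiK two_points tauP' tauP)).
split; first exact: tau_relaut phiK psiK two_points _ tauP.
move=> g; apply: sym_ext => x /=.
rewrite -(tau_conj phiK psiK two_points tauP).
by rewrite (tau_cancel psiK phiK two_points tauP' tauP).
Qed.

End Action.

(** * Small sets *)

Lemma card_le_embedding T U (A : set T) : [set: U] #<= A ->
  exists e : U -> T, injective e /\ forall x, A (e x).
Proof.
move=> /card_leP/unsquash j.
exists (fun x => val (j (SigSub (mem_set (I : [set: U] x))))); split=> [x y|x].
  move=> /val_inj; have /[apply] := 'inj_j; rewrite !inE => /(_ I I).
  by move=> /(congr1 val).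
exact/set_mem/valP.
Qed.

Section Small.
Variables (K : Type) (Kreg : regular_cardinal K).
Local Notation small A := (card_lt A [set: K]).

Lemma card_lt_le T U (A : set T) (B : set U) : A #<= B -> small B -> small A.
Proof.
move=> AB /andP[BK nKB]; rewrite /card_lt (card_le_trans AB BK) /=.
by apply: contra nKB => KA; exact: card_le_trans KA AB.
Qed.

Lemma small_sub T (A B : set T) : A `<=` B -> small B -> small A.
Proof. by move=> /subset_card_le; exact: card_lt_le. Qed.

Lemma small_image T U (f : T -> U) (A : set T) : small A -> small (f @` A).
Proof. exact/card_lt_le/card_image_le. Qed.

Lemma small_finite T (A : set T) : finite_set A -> small A.
Proof.
move=> Afin; have [/infiniteP natK _] := Kreg; apply/andP; split.
  have /finite_setP[n] := Afin; rewrite card_eq_le => /andP[An _].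
  exact: card_le_trans An (card_le_trans (card_leT _) natK).
by apply/negP => /card_le_finite /(_ Afin); exact: Kreg.1.
Qed.

Lemma small_bigcup T (I : set K) (F : K -> set T) : [set: T] #<= [set: K] ->
  small I -> (forall i, I i -> small (F i)) -> small (\bigcup_(i in I) F i).
Proof.
move=> /card_le_embedding[j [injj _]] smallI smallF.
have sj i : I i -> small (j @` F i) by move=> /smallF; exact: small_image.
have := Kreg.2 I (fun i => j @` F i) smallI sj; apply: card_lt_le.
rewrite -image_bigcup.
have /inj_card_eq : {in \bigcup_(i in I) F i &, injective j} by move=> ? ? _ _ /injj.
by rewrite card_eq_sym card_eq_le => /andP[].
Qed.

Lemma small_setU T (A B : set T) : [set: T] #<= [set: K] -> small A -> small B ->
  small (A `|` B).
Proof.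
move=> TK sA sB.
have [k0 _] := infinite_setN0 Kreg.1.
have [k1 k01] : exists k1, k1 <> k0.
  apply: contrapT => /forallNP h; apply: Kreg.1.
  by apply: (sub_finite_set _ (finite_set1 k0)) => k _; apply: contrapT; exact: h.
have : small (\bigcup_(i in [set k0; k1]) if `[< i = k0 >] then A else B).
  apply: small_bigcup => //; first exact/small_finite/finite_set2.
  by move=> i _; case: ifP.
apply: small_sub => x [Ax|Bx]; [exists k0; first by left|exists k1; first by right].
  by rewrite asboolT.
by rewrite asboolF.
Qed.

Lemma well_order_exists (T : Type) : exists lt : T -> T -> Prop,
  [/\ well_founded lt, forall x y, lt x y \/ x = y \/ lt y x &
      forall x y z, lt x y -> lt y z -> lt x z].
Proof.
have [R wo] := wochoice.well_ordering_principle {classic T}.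
have refl x : R x x.
  have [|z [[/eqP-> h] _]] := wo (pred1 x); first by exists x; exact: eqxx.
  by apply: h; exact: eqxx.
have tot x y : R x y \/ R y x.
  have [|z [[+ h] _]] := wo (pred2 x y); first by exists x; rewrite inE eqxx.
  rewrite inE => /orP[]/eqP e; rewrite e in h; [left|right]; apply: h;
    by rewrite inE eqxx ?orbT.
have anti x y : R x y -> R y x -> x = y.
  move=> xy yx; have [|z [_ h]] := wo (pred2 x y); first by exists x; rewrite inE eqxx.
  rewrite -(h x) ?(h y) //; split; rewrite ?inE ?eqxx ?orbT // => w.
    by rewrite inE => /orP[]/eqP->.
  by rewrite inE => /orP[]/eqP->.
have trans x y z : R x y -> R y z -> R x z.
  move=> xy yz; have [|w [[+ h] _]] := wo (pred3 x y z).
    by exists x; rewrite inE eqxx.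
  rewrite inE => /or3P[]/eqP e; rewrite e in h.
  - by apply: h; rewrite inE eqxx !orbT.
  - by rewrite (anti x y) //; apply: h; rewrite inE eqxx.
  - by rewrite -(anti y z) //; apply: h; rewrite inE eqxx ?orbT.
exists (fun x y => R x y /\ x <> y); split.
- move=> x; apply: contrapT => nx.
  have [|z [[nz h] _]] := wo (fun y => `[< ~ Acc (fun x y => R x y /\ x <> y) y >]).
    by exists x; apply/asboolP.
  move/asboolP: nz; apply; constructor=> y [yz nyz]; apply: contrapT => ny.
  by apply: nyz; apply: anti => //; apply: h; apply/asboolP.
- move=> x y; have [->|xy] := pselect (x = y); first by auto.
  by case: (tot x y); [left|right; right]; split=> // /esym.
- move=> x y z [xy nxy] [yz nyz]; split; first exact: trans yz.
  by move=> e; rewrite -e in yz; apply: nxy; exact: anti.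
Qed.

(** An initial ordinal on [K]: if some initial segment of a well-order is not small, the least such
    one receives an embedding of [K], along which the order is pulled back. *)
Lemma small_well_order : exists lt : K -> K -> Prop,
  [/\ well_founded lt, forall x y, lt x y \/ x = y \/ lt y x,
      forall x y z, lt x y -> lt y z -> lt x z &
      forall k, small [set j | lt j k]].
Proof.
have [lt [wf tot trans]] := well_order_exists K.
have [sm|] := pselect (forall k, small [set j | lt j k]); first by exists lt.
move=> /existsNP[k0]; elim/(well_founded_ind wf): k0 => k IH nk.
have [[j [jk nj]]|sm] := pselect (exists j, lt j k /\ ~ small [set i | lt i j]).
  exact: IH nj.
have /card_le_embedding[e [inje ek]] : [set: K] #<= [set j | lt j k].
  apply: contrapT => /negP h; apply: nk; rewrite /card_lt h andbT; exact: card_leT.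
exists (fun x y => lt (e x) (e y)); split.
- exact: Inverse_Image.wf_inverse_image.
- by move=> x y; case: (tot (e x) (e y)) => [|[/inje|]]; auto.
- by move=> x y z; exact: trans.
- move=> y; have : small [set i | lt i (e y)].
    by apply: contrapT => n; apply: sm; exists (e y); split=> //; exact: ek.
  apply: card_lt_le; rewrite -[X in X #<= _]/(e @^-1` [set i | lt i (e y)]).
  by apply: card_ge_preimage => ? ? _ _; exact: inje.
Qed.

(* The Rasiowa-Sikorski argument: a preorder closed under small descending
   chains has a generic chain for any K dense sets. *)
Lemma generic_chain (P : Type) (p0 : P) (le : P -> P -> Prop) (D : K -> set P) :
  (forall x, le x x) -> (forall x y z, le x y -> le y z -> le x z) ->
  (forall (I : set K) (f : K -> P), small I ->
    (forall i j, I i -> I j -> le (f i) (f j) \/ le (f j) (f i)) ->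
    exists p, forall i, I i -> le p (f i)) ->
  (forall k p, exists q, le q p /\ D k q) ->
  exists f : K -> P, (forall k, D k (f k)) /\
    forall I, small I -> exists k, forall i, I i -> le (f k) (f i).
Proof.
move=> refl trans closed dense.
have [lt [wf tot ltt sm]] := small_well_order.
pose ok k (g : forall j, lt j k -> P) q := D k q /\ forall j (h : lt j k), le q (g j h).
pose step k (g : forall j, lt j k -> P) :=
  (* The value [p0] is a default; [fP] shows that along [f] the first branch is always taken. *)
  if pselect (exists q, ok k g q) is left e then projT1 (cid e) else p0.
pose f := Fix wf (fun=> P) step.
have fE k : f k = step k (fun j _ => f j).
  rewrite /f Fix_eq // => x g g' gg'; congr (step x _).
  by apply: functional_extensionality_dep => y; apply: functional_extensionality_dep.
have fP k : D k (f k) /\ forall j, lt j k -> le (f k) (f j).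
  elim/(well_founded_ind wf): k => k IH.
  have [|p pP] := closed [set j | lt j k] f (sm k).
    move=> i j ik jk; have [ij|[->|ji]] := tot i j; last 1 first.
    - by left; have [_] := IH i ik; exact.
    - by right; have [_] := IH j jk; exact.
    - by left.
  have [q [qp Dq]] := dense k p.
  have : exists q, ok k (fun j _ => f j) q.
    by exists q; split=> // j jk; apply: trans qp _; exact: pP.
  by rewrite fE /step; case: pselect => // e _; case: cid.
exists f; split=> [k|I smI]; first by case: (fP k).
(* Regularity: if the small set [I] were unbounded, [K] would be a union of fewer than [K] small
   initial segments. *)
suff [k kP] : exists k, forall i, I i -> lt i k.
  by exists k => i /kP; case: (fP k) => _; exact.
apply: contrapT => /forallNP nk.
have [_] := andP (@small_bigcup K I (fun i => [set j | lt j i] `|` [set i]) (card_lexx _) smI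
   (fun i _ => small_setU (card_lexx _) (sm i) (small_finite (finite_set1 i)))).
move/negP; apply; apply: subset_card_le => k _.
have /existsNP[i /not_implyP[Ii nik]] := nk k.
exists i => //; have [|[->|ki]] := tot i k; [by []|by right|by left].
Qed.

End Small.

(** * Preserving and reversing maps treated uniformly *)

Section Orientation.
Context {d : Order.disp_t} {T : orderType d}.
Implicit Types (e : bool) (x y z : T).

Definition turn e x y z := if e then Cr T x y z else Cr T z y x.

Definition oriented e (f : T -> T) :=
  forall x y z, turn e (f x) (f y) (f z) = Cr T x y z.

Lemma relaut_oriented (f : T -> T) : relaut f <-> exists e, oriented e f.
Proof.
split=> [[fp|fr]|[[] fe]].
- by exists true => x y z; exact: fp.
- by exists false => x y z; exact: fr.
- by left=> x y z; exact: fe.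
- by right=> x y z; exact: fe.
Qed.

Lemma oriented_sym_inv e (f : sym T) : oriented e f -> oriented e (sym_inv_fun f).
Proof.
by case: e => fe x y z; rewrite {1}/turn -[LHS]fe /turn !sym_inv_funK.
Qed.

End Orientation.

(** * The completed circle *)

Section Completion.
Context {d : Order.disp_t} {L : orderType d}.
Local Notation X := (dedekind L).
Implicit Types (x y z : L) (a b c p q r : X).

Definition unbounded_dense := [/\ [set: L] !=set0,
  forall x, exists y, (y < x)%O, forall x, exists y, (x < y)%O &
  forall x y, (x < y)%O -> exists z, (x < z < y)%O].

Lemma principal_subproof x : dedekind_cut [set y | (y <= x)%O].
Proof.
split; [|by exists x => /=|by move=> _; exists x].
apply/seteqP; split=> y /= yx.
  by move=> z /(_ x (lexx x)); exact: le_trans yx.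
by apply: yx => z.
Qed.

Definition principal x : X := Dedekind (principal_subproof x).

Lemma dedekind_leE a b : (a <= b)%O = `[< lower_part a `<=` lower_part b >].
Proof. by []. Qed.

Lemma lower_part_le a x y : lower_part a x -> (y <= x)%O -> lower_part a y.
Proof.
case: (dedekindP a) => -> _ _ ax yx u /ax; exact: le_trans.
Qed.

Lemma principal_le x a : (principal x <= a)%O <-> lower_part a x.
Proof.
rewrite dedekind_leE; split=> [/asboolP|ax]; first by apply => /=.
by apply/asboolP => y /= ; exact: lower_part_le ax.
Qed.

Lemma principal_lt x y : (principal x < principal y)%O = (x < y)%O.
Proof.
rewrite !ltNge; congr (~~ _); apply/idP/idP => [/principal_le//|yx].
exact/principal_le.
Qed.

Lemma principal_inj : injective principal.
Proof.
move=> x y e; apply: le_anti; apply/andP; split; rewrite leNgt -principal_lt e ltxx //.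
Qed.

Lemma principal_eq x y : (principal x == principal y) = (x == y).
Proof. by apply/eqP/eqP => [/principal_inj|->]. Qed.

Lemma Cr_principal x y z : Cr X (principal x) (principal y) (principal z) = Cr L x y z.
Proof. by rewrite /Cr !principal_lt. Qed.

Hypothesis Ldense : unbounded_dense.

Lemma no_endpoint : ~ has_endpoint L.
Proof.
have [_ dn up _] := Ldense.
by case=> -[x xP]; [have [y] := up x|have [y] := dn x]; rewrite ltNge xP.
Qed.

Lemma principal_between a b : (a < b)%O -> exists x, (a < principal x < b)%O.
Proof.
move=> ab; have [x [bx nax]] : exists x, lower_part b x /\ ~ lower_part a x.
  apply: contrapT => /forallNP h; move: ab; rewrite ltNge dedekind_leE => /negP; apply.
  by apply/asboolP => x bx; apply: contrapT => ax; apply: (h x).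
have [u [ua ux]] : exists u, ubound (lower_part a) u /\ (u < x)%O.
  apply: contrapT => /forallNP h; apply: nax; case: (dedekindP a) => -> _ _ u ua.
  by rewrite leNgt; apply/negP => ux; apply: (h u).
have [_ _ _ /(_ u x ux)[z /andP[uz zx]]] := Ldense.
exists z; apply/andP; split.
  by rewrite ltNge; apply/negP => /principal_le/ua; rewrite leNgt uz.
by apply: (@lt_le_trans _ _ (principal x)); [rewrite principal_lt|apply/principal_le].
Qed.

Lemma principal_below a : exists x, (principal x < a)%O.
Proof.
have [_ dn _ _] := Ldense; case: (dedekindP a) => _ [x ax] _.
have [y yx] := dn x; exists y.
by apply: (@lt_le_trans _ _ (principal x)); [rewrite principal_lt|apply/principal_le].
Qed.

Lemma principal_dense a b : a != b -> exists x, Cr X a (principal x) b.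
Proof.
move=> ab; case: (ltgtP a b) ab => // [ab|ba] _.
  by have [x axb] := principal_between ab; exists x; rewrite /Cr axb.
by have [x xb] := principal_below b; exists x; move: xb ba; cyc [:: a; b; principal x].
Qed.

Lemma dedekind_dense a b : a != b -> exists p, Cr X a p b.
Proof. by move=> /principal_dense[x axb]; exists (principal x). Qed.

Lemma dense_circle x y : x != y -> exists z, Cr L x z y.
Proof. by rewrite -principal_eq => /principal_dense[z]; rewrite Cr_principal; exists z. Qed.

(** Since [L] has no endpoint, the full cut is a point of the completion, so an unbounded [S] has a
    supremum as well. *)
Lemma dedekind_sup (S : set X) : S !=set0 ->
  exists q, (forall s, S s -> (s <= q)%O) /\
    forall b, (forall s, S s -> (s <= b)%O) -> (q <= b)%O.
Proof.
move=> [s0 Ss0]; pose U : set L := \bigcup_(s in S) lower_part s.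
have cut : dedekind_cut (lbound (ubound U)).
  split; last by move=> /no_endpoint.
    apply/seteqP; split=> x xU u uU; first exact: uU.
    by apply: xU => w; exact.
  case: (dedekindP s0) => _ [x sx] _; exists x => u; apply; by exists s0.
exists (Dedekind cut); split=> [s Ss|b bS]; rewrite dedekind_leE; apply/asboolP => x /= xP.
  by move=> u; apply; exists s.
case: (dedekindP b) => -> _ _ u bu; apply: xP => y [s Ss sy]; apply: bu.
by have := bS _ Ss; rewrite dedekind_leE => /asboolP; exact.
Qed.

(** Seen from [c], the circle runs up to the top and resumes below [c]. The separating point is the
    supremum of the part of [S] below [c] if there is one, that of [S] if [R] starts above [c], and
    the top point if [S] lies above [c] and [R] below. *)
Lemma dedekind_arc_complete : @arc_complete _ X.
Proof.
move=> c S R S0 R0 SR.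
have Sc s : S s -> s != c.
  have [r Rr] := R0; move=> /SR/(_ Rr); cyc [:: c; s; r].
have Rc r : R r -> r != c.
  have [s Ss] := S0; move=> /(SR _ _ Ss); cyc [:: c; s; r].
have [[s0 [Ss0 s0c]]|Sgt] := pselect (exists s, S s /\ (s < c)%O).
  have Rlt s r : S s -> (s < c)%O -> R r -> (s < r < c)%O.
    by move=> /SR h sc /h; move: sc; cyc [:: s; c; r].
  have [q [Sq qmin]] := @dedekind_sup [set s | S s /\ (s < c)%O] (ex_intro _ s0 (conj Ss0 s0c)).
  have qR r : R r -> (q <= r)%O.
    move=> Rr; apply: qmin => s [Ss sc]; have /andP[/ltW//] := Rlt _ _ Ss sc Rr.
  have [r0 Rr0] := R0; have r0c : (r0 < c)%O by have /andP[] := Rlt _ _ Ss0 s0c Rr0.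
  have qc : (q < c)%O by exact: le_lt_trans (qR _ Rr0) r0c.
  exists q; split=> [s Ss|r Rr].
    have [sc|cs] := ltP s c.
      by have : (s <= q)%O by [exact: Sq]; rewrite leNgt; move: sc qc; cyc [:: s; q; c].
    by move: (Sc _ Ss) cs qc; rewrite leNgt; cyc [:: s; q; c].
  move: (qR _ Rr) (Rlt _ _ Ss0 s0c Rr) qc; rewrite leNgt; cyc [:: s0; q; c; r].
have {}Sgt s : S s -> (c < s)%O.
  move=> Ss; have : ~~ (s < c)%O by apply/negP => sc; apply: Sgt; exists s.
  by move: (Sc _ Ss); cyc [:: s; c].
have [[r0 [Rr0 r0c]]|Rlt] := pselect (exists r, R r /\ (c < r)%O).
  have [q [Sq qmin]] := dedekind_sup S0.
  have [s0 Ss0] := S0; have cs0 := Sgt _ Ss0; have s0q := Sq _ Ss0.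
  exists q; split=> [s Ss|r Rr].
    by move: (Sgt _ Ss) (Sq _ Ss); rewrite leNgt; cyc [:: s; q; c].
  have [cr|rc] := ltP c r; last first.
    by move: (Rc _ Rr) cs0 s0q rc; rewrite !leNgt; cyc [:: s0; q; c; r].
  have : (q <= r)%O.
    apply: qmin => s Ss; move: (SR _ _ Ss Rr) (Sgt _ Ss) cr; rewrite leNgt.
    by cyc [:: s; c; r].
  by move: cs0 s0q cr; rewrite !leNgt; cyc [:: s0; q; c; r].
have [q [qtop _]] := @dedekind_sup setT (ex_intro _ c I).
have [s0 Ss0] := S0; exists q; split=> [s Ss|r Rr].
  by move: (Sgt _ Ss) (qtop s I); rewrite leNgt; cyc [:: s; q; c].
have : ~~ (c < r)%O by apply/negP => cr; apply: Rlt; exists r.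
by move: (Rc _ Rr) (Sgt _ Ss0) (qtop s0 I); rewrite leNgt; cyc [:: s0; q; c; r].
Qed.

Lemma turn_complete e c (S R : set X) : S !=set0 -> R !=set0 ->
  (forall s r, S s -> R r -> turn e c s r) ->
  exists q, (forall s, S s -> (s == q) || turn e c s q) /\
            (forall r, R r -> (q == r) || turn e c q r).
Proof.
case: e => S0 R0 SR; first exact: dedekind_arc_complete.
have [|q [qR qS]] := dedekind_arc_complete R0 S0 (c := c).
  by move=> r s Rr Ss; rewrite CrC; exact: (SR s r).
exists q; split=> [s Ss|r Rr]; rewrite /turn eq_sym CrC CrC; first exact: qS.
exact: qR.
Qed.

(** At a gap, opening the circle at [x0] splits the remaining points of [L] into those before and
    those after [p]; the value is a point separating their images. *)
Lemma ext_point e (g : L -> L) p : oriented e g -> exists q,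
  (forall x, p = principal x -> q = principal (g x)) /\
  forall x y, Cr X (principal x) p (principal y) -> turn e (principal (g x)) q (principal (g y)).
Proof.
move=> ge; have gX x y z : turn e (principal (g x)) (principal (g y)) (principal (g z)) =
    Cr X (principal x) (principal y) (principal z).
  by rewrite Cr_principal -ge /turn !Cr_principal.
have [[x0 ->]|np] := pselect (exists x, p = principal x).
  by exists (principal (g x0)); split=> [x /principal_inj->//|x y]; rewrite gX.
have [[x0 _] _ _ _] := Ldense.
have px0 x : p != principal x by apply/eqP => px; apply: np; exists x.
have x0p x : principal x != p by rewrite eq_sym.
pose S := [set q | exists2 x, Cr X (principal x0) (principal x) p & q = principal (g x)].
pose R := [set q | exists2 x, Cr X p (principal x) (principal x0) & q = principal (g x)].
have [|||q [Sq qR]] := @turn_complete e (principal (g x0)) S R.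
- by have [x xP] := principal_dense (x0p x0); exists (principal (g x)), x.
- by have [x xP] := principal_dense (px0 x0); exists (principal (g x)), x.
- move=> _ _ [x xS ->] [y yR ->]; rewrite gX; move: xS yR.
  by cyc [:: principal x0; principal x; principal y; p].
exists q; split=> [x /eqP|x y xpy]; first by rewrite (negbTE (px0 _)).
(* Separation by [q] is only weak. Points of [L] closer to [p] than the given ones and than [x0]
   make the conclusion strict. *)
have [|x' x'P] := @principal_dense
    (if Cr X (principal x) (principal x0) p then principal x0 else principal x) p.
  by case: ifP.
have [|y' y'P] := @principal_dense p
    (if Cr X p (principal x0) (principal y) then principal x0 else principal y).
  by case: ifP.
have x0x'p : Cr X (principal x0) (principal x') p.
  by case: ifP x'P => //; move: (x0p x0) (x0p x);
    cyc [:: p; principal x; principal x0; principal x'].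
have py'x0 : Cr X p (principal y') (principal x0).
  by case: ifP y'P => //; move: (x0p x0) (x0p y);
    cyc [:: p; principal y; principal x0; principal y'].
have sx' : S (principal (g x')) by exists x'.
have ry' : R (principal (g y')) by exists y'.
have xx'p : Cr X (principal x) (principal x') p.
  by case: ifP x'P => //; cyc [:: p; principal x; principal x0; principal x'].
have py'y : Cr X p (principal y') (principal y).
  by case: ifP y'P => //; cyc [:: p; principal y; principal x0; principal y'].
have /[!(=^~ gX)] x0x'y' : Cr X (principal x0) (principal x') (principal y').
  by move: x0x'p py'x0; cyc [:: p; principal x0; principal x'; principal y'].
have /[!(=^~ gX)] xx'y' : Cr X (principal x) (principal x') (principal y').
  by move: xx'p py'y xpy; cyc [:: principal x; principal x'; principal y'; p; principal y].
have /[!(=^~ gX)] x'y'y : Cr X (principal x') (principal y') (principal y).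
  by move: xx'p py'y xpy; cyc [:: principal x; principal x'; principal y'; p; principal y].
have /[!(=^~ gX)] xx'y : Cr X (principal x) (principal x') (principal y).
  by move: xx'p py'y xpy; cyc [:: principal x; principal x'; p; principal y].
have : [|| q == principal (g x'), q == principal (g y') |
    turn e (principal (g x')) q (principal (g y'))].
  move: (Sq _ sx') (qR _ ry') x0x'y'; rewrite /turn; case: (e);
    by cyc [:: principal (g x0); principal (g x'); principal (g y'); q].
by move: xx'y' x'y'y xx'y; rewrite /turn; case: (e);
  cyc [:: principal (g x); principal (g x'); principal (g y'); q; principal (g y)].
Qed.

(** An oriented map that fixes the dense set of principal points is the identity, so the extensions
    of [g] and of its inverse are inverse to each other. *)
Lemma ext_exists e (g : sym L) : oriented e g ->
  exists h : sym X, oriented e h /\ forall x, h (principal x) = principal (g x).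
Proof.
have ext (f : L -> L) : oriented e f ->
    exists h : X -> X, oriented e h /\ forall x, h (principal x) = principal (f x).
  move=> fe; have /choice[h hP] := fun p => ext_point p fe.
  exists h; split=> [|x]; last by case: (hP (principal x)) => + _; exact.
  suff hturn p q r : Cr X p q r -> turn e (h p) (h q) (h r).
    rewrite /turn; case: (e) hturn => hturn p q r; rewrite /turn.
      by apply: Cr_homo.
    by rewrite (Cr_anti_homo (fun p q r => hturn p q r)).
  move=> pqr; have [pq qr pr] := Cr_neq pqr; have rp : r != p by rewrite eq_sym.
  have [x pxq] := principal_dense pq; have [y qyr] := principal_dense qr.
  have [z rzp] := principal_dense rp.
  have : Cr L x y z.
    by rewrite -Cr_principal; move: pqr pxq qyr rzp;
      cyc [:: p; q; r; principal x; principal y; principal z].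
  rewrite -fe.
  have /(hP p).2 : Cr X (principal z) p (principal x).
    by move: pqr pxq rzp; cyc [:: p; q; r; principal x; principal z].
  have /(hP q).2 : Cr X (principal x) q (principal y).
    by move: pqr pxq qyr; cyc [:: p; q; r; principal x; principal y].
  have /(hP r).2 : Cr X (principal y) r (principal z).
    by move: pqr rzp qyr; cyc [:: p; q; r; principal y; principal z].
  by rewrite /turn; case: (e); rewrite -Cr_principal;
    cyc [:: h p; h q; h r; principal (f x); principal (f y); principal (f z)].
have turnK (h h' : X -> X) : oriented e h -> oriented e h' ->
    (forall x, h' (h (principal x)) = principal x) -> cancel h h'.
  move=> he h'e hK p; apply/eqP; apply: contrapT => /negP kp.
  have pk : p != h' (h p) by rewrite eq_sym.
  have [x px] := principal_dense kp; have [y py] := principal_dense pk.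
  have : Cr X (principal x) p (principal y).
    by move: px py; cyc [:: p; h' (h p); principal x; principal y].
  rewrite -he /turn; case: (e) he h'e => he h'e; rewrite -h'e /turn !hK.
    by move: px py; cyc [:: p; h' (h p); principal x; principal y].
  by move: px py; cyc [:: p; h' (h p); principal x; principal y].
move=> ge; have [h [he hP]] := ext _ ge.
have [h' [he' hP']] := ext _ (oriented_sym_inv ge).
have hK : cancel h h' by apply: turnK => // x; rewrite hP hP' sym_funK.
have hK' : cancel h' h by apply: turnK => // x; rewrite hP' hP sym_inv_funK.
by exists (Sym hK hK').
Qed.

Lemma relaut_unique (h h' : sym X) : relaut h -> relaut h' ->
  (forall x, h (principal x) = h' (principal x)) -> h = h'.
Proof.
move=> rh rh' hh'.
suff /(congr1 (mul h')) : h'^-1 * h = 1 by rewrite mulVKg mulg1.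
apply: sym_ext => p /=; apply/eqP; apply: contrapT => /negP kp.
have rk : relaut (h'^-1 * h : sym X).
  by apply: relaut_comp => //; exact: relaut_sym_inv.
have [a [b [/Cr_neq[_ _ ab] nab]]] := wiggle dedekind_dense rk kp.
have [x axb] := principal_dense ab; have := nab _ axb.
by rewrite /= hh' sym_funK axb.
Qed.

(** Made total so that it can be composed with group morphisms; the value 1 is a default for
    permutations that neither preserve nor reverse the circle. *)
Definition extend (g : sym L) : sym X :=
  if pselect (exists h : sym X, relaut h /\ forall x, h (principal x) = principal (g x))
    is left e then projT1 (cid e) else 1.

Lemma extendP (g : sym L) : relaut g ->
  relaut (extend g) /\ forall x, extend g (principal x) = principal (g x).
Proof.
move=> /relaut_oriented[e /ext_exists[h [he hP]]]; rewrite /extend.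
case: pselect => [H|[]]; first by case: cid.
by exists h; split=> //; apply/relaut_oriented; exists e.
Qed.

Lemma extend_unique (g : sym L) (h : sym X) : relaut g -> relaut h ->
  (forall x, h (principal x) = principal (g x)) -> extend g = h.
Proof.
move=> rg rh hP; have [re eP] := extendP rg.
by apply: relaut_unique => // x; rewrite eP hP.
Qed.

Lemma extend_preserving (g : sym L) :
  preserving (Cr L) g -> preserving (Cr X) (extend g).
Proof.
move=> pg; have [|h [he hP]] := @ext_exists true g; first by move=> x y z; exact: pg.
rewrite (@extend_unique g h) //; [by left|left].
by move=> x y z; exact: he.
Qed.

Lemma extendM (g g' : sym L) : relaut g -> relaut g' ->
  extend (g * g') = extend g * extend g'.
Proof.
move=> rg rg'; have [re eP] := extendP rg; have [re' eP'] := extendP rg'.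
apply: extend_unique; first exact: relaut_comp.
  exact: relaut_comp.
by move=> x /=; rewrite eP' eP.
Qed.

Lemma extend_inj (g g' : sym L) : relaut g -> relaut g' ->
  extend g = extend g' -> g = g'.
Proof.
move=> /extendP[_ eP] /extendP[_ eP'] e; apply: sym_ext => x.
by apply: principal_inj; rewrite -eP -eP' e.
Qed.

End Completion.

(** * Homogeneity of alpha-sets *)

Section AlphaSet.
Variables (K : Type) (Kreg : regular_cardinal K).
Context {d : Order.disp_t} {L : orderType d}.
Hypothesis Lalpha : alpha_set K L.
Local Notation X := (dedekind L).
Local Notation principal := (@principal d L).
Local Notation small A := (card_lt A [set: K]).
Implicit Types (x y z : L) (a b p q r : X).

Lemma alpha_card : [set: L] #<= [set: K].
Proof. by have := Lalpha.1; rewrite card_eq_le => /andP[]. Qed.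

Lemma alpha_unbounded_dense : unbounded_dense (L := L).
Proof.
have s0 : small (@set0 L) by exact/small_finite/finite_set0.
have s1 x : small [set x] by apply: small_finite => //; exact: finite_set1.
have [_ btw] := Lalpha; split.
- by have [|z _] := btw set0 set0 s0 s0; [|exists z].
- by move=> x; have [//|z [_ h]] := btw _ _ s0 (s1 x); exists z; exact: h.
- by move=> x; have [|z [h _]] := btw _ _ (s1 x) s0; [|exists z; exact: h].
- move=> x y xy; have [_ _ -> ->//|z [h h']] := btw _ _ (s1 x) (s1 y).
  by exists z; rewrite h // h'.
Qed.
Let Ldense := alpha_unbounded_dense.

(* Both sides of [p] have cofinality at least that of [K], expressed through [Cr]
   alone so as to be invariant under all homeomorphisms of the circle. *)
Definition uncofinal p := forall U : set X, small U -> ~ U p ->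
  (exists a, forall u, U u -> Cr X p a u) /\ (exists b, forall u, U u -> Cr X p u b).

Lemma uncofinal_relaut (h : sym X) p : relaut h -> uncofinal p -> uncofinal (h p).
Proof.
move=> /relaut_oriented[e he] pK U sU nU.
have [||[a aP] [b bP]] := pK (sym_inv_fun h @` U); first exact: small_image.
  by move=> [u Uu up]; apply: nU; rewrite -up sym_inv_funK.
have {}aP u : U u -> Cr X p a (sym_inv_fun h u) by move=> Uu; apply: aP; exists u.
have {}bP u : U u -> Cr X p (sym_inv_fun h u) b by move=> Uu; apply: bP; exists u.
case: e he => he; split; [exists (h a)|exists (h b)|exists (h b)|exists (h a)] => u.
- by move=> /aP; rewrite -he /turn sym_inv_funK.
- by move=> /bP; rewrite -he /turn sym_inv_funK.
- by move=> /bP; rewrite -he /turn sym_inv_funK CrC CrC.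
- by move=> /aP; rewrite -he /turn sym_inv_funK CrC CrC.
Qed.

(** Each [u] is replaced by a point of [L] between it and [x], which brings the small set into [L],
    where the alpha-set property applies on either side of [x]. *)
Lemma uncofinal_principal x : uncofinal (principal x).
Proof.
have s1 : small [set x] by apply: small_finite => //; exact: finite_set1.
move=> U sU nU; split.
  have /choice[l lP] u : exists y, u <> principal x -> Cr X (principal x) (principal y) u.
    have [->|/eqP ux] := pselect (u = principal x); first by exists x.
    by have [|y yP] := @principal_dense _ _ Ldense (principal x) u; [rewrite eq_sym|exists y].
  have [||y z -> []//|z [xz zl]] := Lalpha.2 [set x] [set y | (x < y)%O /\ (l @` U) y] => //.
    by apply: (@small_sub _ _ _ (l @` U)); [move=> y []|exact: small_image].
  exists (principal z) => u Uu.
  have /lP lu : u <> principal x by move=> ux; apply: nU; rewrite -ux.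
  have {}xz : (principal x < principal z)%O by rewrite principal_lt; exact: xz.
  have [xl|lx] := ltP x (l u).
    have : (principal z < principal (l u))%O.
      by rewrite principal_lt; apply: zl; split=> //; exists u.
    by move: lu xz; cyc [:: principal x; principal z; principal (l u); u].
  have : ~~ (principal x < principal (l u))%O by rewrite -leNgt leNgt principal_lt ltNge lx.
  by move: lu xz; cyc [:: principal x; principal z; principal (l u); u].
have /choice[l lP] u : exists y, u <> principal x -> Cr X u (principal y) (principal x).
  have [->|/eqP ux] := pselect (u = principal x); first by exists x.
  by have [y yP] := @principal_dense _ _ Ldense u (principal x) ux; exists y.
have [||y z [yx _] ->//|z [zl xz]] := Lalpha.2 [set y | (y < x)%O /\ (l @` U) y] [set x] => //.
  by apply: (@small_sub _ _ _ (l @` U)); [move=> y []|exact: small_image].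
exists (principal z) => u Uu.
have /lP lu : u <> principal x by move=> ux; apply: nU; rewrite -ux.
have {}xz : (principal z < principal x)%O by rewrite principal_lt; exact: xz.
have [xl|lx] := ltP (l u) x.
  have : (principal (l u) < principal z)%O.
    by rewrite principal_lt; apply: zl; split=> //; exists u.
  by move: lu xz; cyc [:: principal x; principal z; principal (l u); u].
have : ~~ (principal (l u) < principal x)%O by rewrite -leNgt leNgt principal_lt ltNge lx.
by move: lu xz; cyc [:: principal x; principal z; principal (l u); u].
Qed.

(** The alpha-set property of the circle opened at [p]. If [U] or [V] is empty, the bound comes from
    [p] itself; otherwise the cases record where the end of the chain [L] falls relative to [U] and
    [V]. *)
Lemma uncofinal_between p (U V : set L) : uncofinal p -> small U -> small V ->
  (forall x, U x -> principal x != p) -> (forall x, V x -> principal x != p) ->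
  (forall x y, U x -> V y -> Cr X p (principal x) (principal y)) ->
  exists z, [/\ principal z != p, forall x, U x -> Cr X p (principal x) (principal z) &
    forall y, V y -> Cr X p (principal z) (principal y)].
Proof.
move=> pK sU sV nU nV UV.
have nUp : ~ (principal @` U) p by move=> [x /nU/eqP].
have nVp : ~ (principal @` V) p by move=> [x /nV/eqP].
have [_ [b bP]] := pK _ (small_image principal sU) nUp.
have [[a aP] _] := pK _ (small_image principal sV) nVp.
have {}bP x : U x -> Cr X p (principal x) b by move=> Ux; apply: bP; exists x.
have {}aP x : V x -> Cr X p a (principal x) by move=> Vx; apply: aP; exists x.
have [[y0 Vy0]|V0] := pselect (V !=set0); last first.
  have {}V0 y : ~ V y by move=> Vy; apply: V0; exists y.
  have [[x0 Ux0]|U0] := pselect (U !=set0); last first.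
    have [[x _] _ up _] := Ldense; have [y xy] := up x.
    have {}U0 z : ~ U z by move=> Uz; apply: U0; exists z.
    have [xp|xp] := eqVneq (principal x) p; last by exists x; split=> // ? => [/U0|/V0].
    exists y; split=> [|? /U0|? /V0] //.
    by rewrite -xp principal_eq; move: xy; cyc [:: x; y].
  have [|z bzp] := @principal_dense _ _ Ldense b p.
    by move: (bP _ Ux0); cyc [:: p; b; principal x0].
  exists z; split=> [|x /bP|? /V0//]; move: bzp; first by cyc [:: p; b; principal z].
  by cyc [:: p; b; principal z; principal x].
have [[x0 Ux0]|U0] := pselect (U !=set0); last first.
  have {}U0 z : ~ U z by move=> Uz; apply: U0; exists z.
  have [|z paz] := @principal_dense _ _ Ldense p a.
    by move: (aP _ Vy0); cyc [:: p; a; principal y0].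
  exists z; split=> [|? /U0//|x /aP]; move: paz; first by cyc [:: p; a; principal z].
  by cyc [:: p; a; principal z; principal x].
have [[y1 [Vy1 py1]]|Vlt] := pselect (exists y, V y /\ (p < principal y)%O).
  have Ugt x : U x -> (p < principal x < principal y1)%O.
    by move=> /UV/(_ Vy1); move: py1; cyc [:: p; principal x; principal y1].
  have [||x y Ux [Vy py]|z [Uz zV]] := Lalpha.2 U [set y | V y /\ (p < principal y)%O].
  - exact: sU.
  - by apply: small_sub sV => y [].
  - have /andP[px _] := Ugt _ Ux; rewrite -principal_lt.
    by move: (UV _ _ Ux Vy) px py; cyc [:: p; principal x; principal y].
  have pz : (p < principal z)%O.
    by move: (Ugt _ Ux0) (Uz _ Ux0); rewrite -principal_lt;
      cyc [:: p; principal x0; principal y1; principal z].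
  exists z; split=> [|x Ux|y Vy].
  - by move: pz; cyc [:: p; principal z].
  - by move: (Ugt _ Ux) (Uz _ Ux); rewrite -principal_lt;
      cyc [:: p; principal x; principal y1; principal z].
  - have [py|yp] := ltP p (principal y).
      by move: pz (zV _ (conj Vy py)); rewrite -principal_lt;
        cyc [:: p; principal y; principal z].
    by move: pz yp (nV _ Vy); rewrite leNgt; cyc [:: p; principal y; principal z].
have {}Vlt y : V y -> (principal y < p)%O.
  move=> Vy; have : ~~ (p < principal y)%O by apply/negP => py; apply: Vlt; exists y.
  by move: (nV _ Vy); cyc [:: p; principal y].
have [[x1 [Ux1 x1p]]|Ugt] := pselect (exists x, U x /\ (principal x < p)%O).
  have [||x y [Ux xp] Vy|z [Uz zV]] := Lalpha.2 [set x | U x /\ (principal x < p)%O] V.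
  - by apply: small_sub sU => x [].
  - exact: sV.
  - by rewrite -principal_lt; move: (UV _ _ Ux Vy) xp (Vlt _ Vy);
      cyc [:: p; principal x; principal y].
  have zp : (principal z < p)%O.
    by move: (Vlt _ Vy0) (zV _ Vy0); rewrite -principal_lt;
      cyc [:: p; principal y0; principal z].
  exists z; split=> [|x Ux|y Vy].
  - by move: zp; cyc [:: p; principal z].
  - have [xp|px] := ltP (principal x) p.
      by move: zp (Uz _ (conj Ux xp)); rewrite -principal_lt;
        cyc [:: p; principal x; principal z].
    by move: zp px (nU _ Ux); rewrite leNgt; cyc [:: p; principal x; principal z].
  - by move: (Vlt _ Vy) (zV _ Vy); rewrite -principal_lt;
      cyc [:: p; principal y; principal z].
have {}Ugt x : U x -> (p < principal x)%O.
  move=> Ux; have : ~~ (principal x < p)%O by apply/negP => xp; apply: Ugt; exists x.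
  by move: (nU _ Ux); cyc [:: p; principal x].
have [|z [Uz _]] := Lalpha.2 U set0 sU (small_finite Kreg (finite_set0 _)) => //.
have pz : (p < principal z)%O.
  by move: (Ugt _ Ux0) (Uz _ Ux0); rewrite -principal_lt;
    cyc [:: p; principal x0; principal z].
exists z; split=> [|x Ux|y Vy].
- by move: pz; cyc [:: p; principal z].
- by move: (Ugt _ Ux) (Uz _ Ux); rewrite -principal_lt; cyc [:: p; principal x; principal z].
- by move: pz (Vlt _ Vy); cyc [:: p; principal y; principal z].
Qed.

(* The last clause lets the base points themselves be matched when they lie in
   [L], so that the case of gaps is treated at the same time. *)
Definition compatible (p p' : X) (u v : L * L) :=
  [/\ Cr X p (principal u.1) (principal v.1) = Cr X p' (principal u.2) (principal v.2),
      (u.1 == v.1) = (u.2 == v.2) & (principal u.1 == p) = (principal u.2 == p')].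

Definition partial_iso (p p' : X) (U : set (L * L)) :=
  [/\ small (fst @` U), small (snd @` U) & forall u v, U u -> U v -> compatible p p' u v].

Definition converse (U : set (L * L)) : set (L * L) := [set u | U (u.2, u.1)].

Lemma partial_iso_converse p p' U : partial_iso p p' U -> partial_iso p' p (converse U).
Proof.
move=> [s1 s2 c]; split=> [||u v Uu Uv].
- by apply: small_sub s2 => x [[y z] Uyz <-]; exists (z, y).
- by apply: small_sub s1 => x [[y z] Uyz <-]; exists (z, y).
- by have [] := c _ _ Uu Uv.
Qed.

(** The forth step; the back step is this one applied to [converse]. The new value must separate the
    images of the points before [x] from those of the points after [x], both seen from [p]. *)
Lemma partial_iso_extend p p' U x : uncofinal p' ->
  ((exists x, p = principal x) -> exists y, p' = principal y) ->
  partial_iso p p' U ->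
  exists y, partial_iso p p' (U `|` [set (x, y)]).
Proof.
move=> pK pp' [s1 s2 c].
have [[y Uxy]|nU] := pselect (exists y, U (x, y)).
  exists y; suff -> : U `|` [set (x, y)] = U by [].
  by apply/seteqP; split=> u; [move=> [//|->]|left].
have Ux u : U u -> u.1 != x.
  by case: u => u v Uuv; apply/eqP => /= ux; apply: nU; exists v; rewrite -ux.
have small_add (V W : set L) (z : L) : small V -> W `<=` V `|` [set z] -> small W.
  move=> sV; move/small_sub; apply; apply: small_setU => //; first exact: alpha_card.
  by apply: small_finite => //; exact: finite_set1.
suff [y yP] : exists y, (principal x == p) = (principal y == p') /\ forall u, U u ->
    [/\ Cr X p (principal u.1) (principal x) = Cr X p' (principal u.2) (principal y),
        Cr X p (principal x) (principal u.1) = Cr X p' (principal y) (principal u.2) &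
        u.2 != y].
  exists y; split.
  - apply: (small_add _ _ x s1) => _ [u [Uu|->] <-]; last by right.
    by left; exists u.
  - apply: (small_add _ _ y s2) => _ [u [Uu|->] <-]; last by right.
    by left; exists u.
  case: yP => yp yP u v [Uu|->] [Uv|->] /=; first exact: c.
  - have [_ _ up] := c _ _ Uu Uu; have [e1 _ uy] := yP _ Uu.
    by split=> //=; rewrite (negbTE uy) (negbTE (Ux _ Uu)).
  - have [_ e2 uy] := yP _ Uv.
    by split=> //=; rewrite eq_sym [RHS]eq_sym (negbTE uy) (negbTE (Ux _ Uv)).
  - split=> //=; first by cyc [:: p; p'; principal x; principal y].
    by rewrite !eqxx.
have [/eqP xp|xp] := boolP (principal x == p).
  have [|y yp] := pp'; first by exists x.
  exists y; rewrite yp eqxx; split=> // u Uu.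
  have [_ _] := c _ _ Uu Uu; rewrite -xp yp !principal_eq (negbTE (Ux _ Uu)) => /esym/negbT uy.
  by split=> //; cyc [:: principal x; principal u.1; principal y; principal u.2].
pose U1 := [set z | exists u, [/\ U u, u.2 = z & Cr X p (principal u.1) (principal x)]].
pose U2 := [set z | exists u, [/\ U u, u.2 = z & Cr X p (principal x) (principal u.1)]].
have [|||||y [yp yU1 yU2]] := @uncofinal_between p' U1 U2 pK.
- by apply: small_sub s2 => z [u [Uu uz _]]; exists u.
- by apply: small_sub s2 => z [u [Uu uz _]]; exists u.
- move=> _ [u [Uu <- uP]]; have [_ _ <-] := c _ _ Uu Uu.
  by move: uP; cyc [:: p; principal u.1; principal x].
- move=> _ [u [Uu <- uP]]; have [_ _ <-] := c _ _ Uu Uu.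
  by move: uP; cyc [:: p; principal u.1; principal x].
- move=> _ _ [u [Uu <- uP]] [v [Uv <- vP]]; have [<- _ _] := c _ _ Uu Uv.
  by move: uP vP; cyc [:: p; principal u.1; principal v.1; principal x].
exists y; rewrite (negbTE yp); split=> // u Uu.
have [_ _ up] := c _ _ Uu Uu.
have [e|ne] := eqVneq (principal u.1) p.
  have e' : principal u.2 = p' by apply/eqP; rewrite -up; exact/eqP.
  rewrite e e' -principal_eq e'; split; [| |by rewrite eq_sym].
    by cyc [:: p; principal x; p'; principal y].
  by cyc [:: p; principal x; p'; principal y].
have ux : principal u.1 != principal x by rewrite principal_eq Ux.
rewrite -principal_eq; have [h|h] := boolP (Cr X p (principal u.1) (principal x)).
  have /yU1 h' : U1 u.2 by exists u.
  have [n n'] : ~~ Cr X p (principal x) (principal u.1) /\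
      ~~ Cr X p' (principal y) (principal u.2).
    split; move: h h'; first by cyc [:: p; principal x; principal u.1].
    by cyc [:: p'; principal y; principal u.2].
  rewrite h' (negbTE n) (negbTE n'); split=> //.
  by move: h'; cyc [:: p'; principal y; principal u.2].
have k : Cr X p (principal x) (principal u.1).
  by move: h ne ux xp; cyc [:: p; principal x; principal u.1].
have /yU2 k' : U2 u.2 by exists u.
have n' : ~~ Cr X p' (principal u.2) (principal y).
  by move: k'; cyc [:: p'; principal y; principal u.2].
rewrite k k' (negbTE n'); split=> //.
by move: k'; cyc [:: p'; principal y; principal u.2].
Qed.

Lemma enumeration : exists e : K -> L, forall x, exists k, e k = x.
Proof.
have /card_le_embedding[j [injj _]] := alpha_card.
have [[x0 _] _ _ _] := Ldense.
exists (fun k => if pselect (exists x, j x = k) is left h then projT1 (cid h) else x0).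
move=> x; exists (j x); case: pselect => [h|[]]; last by exists x.
by case: cid => y /= /injj.
Qed.

(** Back and forth of length [K] through [generic_chain]: a condition is a small partial isomorphism
    containing [U0], and [D k] asks for [e k] in both domain and range. Regularity keeps unions of
    small chains small. *)
Lemma partial_iso_total p p' (U0 : set (L * L)) : uncofinal p -> uncofinal p' ->
  (exists x, p = principal x) <-> (exists x, p' = principal x) ->
  partial_iso p p' U0 ->
  exists g : sym L, (forall x y, U0 (x, y) -> g x = y) /\
    forall x y, compatible p p' (x, g x) (y, g y).
Proof.
move=> pK pK' pp' iso0; have [e eP] := enumeration.
pose P := {U | partial_iso p p' U /\ U0 `<=` U}.
pose le (U V : P) := sval V `<=` sval U.
pose D k := [set U : P | (exists y, sval U (e k, y)) /\ (exists x, sval U (x, e k))].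
pose mk U (isoU : partial_iso p p' U) (subU : U0 `<=` U) : P := exist _ U (conj isoU subU).
pose P0 : P := mk U0 iso0 (@subset_refl _ U0).
have [||||f [fD fdir]] := @generic_chain K Kreg P P0 le D.
- by move=> U.
- by move=> U V W UV VW; exact: subset_trans UV.
- move=> I f sI fchain.
  have [I0|/set0P/negP/negPn/eqP I0] := pselect (I !=set0); last first.
    by exists P0 => i; rewrite I0.
  pose V := \bigcup_(i in I) sval (f i).
  have isoV : partial_iso p p' V.
    split.
    - rewrite image_bigcup; apply: small_bigcup => //; first exact: alpha_card.
      by move=> i _; case: (svalP (f i)) => -[].
    - rewrite image_bigcup; apply: small_bigcup => //; first exact: alpha_card.
      by move=> i _; case: (svalP (f i)) => -[].
    - move=> u v [i Ii iu] [j Ij jv]; case: (fchain i j Ii Ij) => [/(_ _ jv)|/(_ _ iu)] h.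
        by case: (svalP (f i)) => -[_ _ c] _; exact: c.
      by case: (svalP (f j)) => -[_ _ c] _; exact: c.
  have UV : U0 `<=` V.
    by case: I0 => i Ii u U0u; exists i => //; case: (svalP (f i)) => _; exact.
  by exists (mk V isoV UV) => i Ii u iu; exists i.
- move=> k [U [isoU U0U]].
  have [y iso1] := partial_iso_extend (e k) pK' pp'.1 isoU.
  have [x iso2] := partial_iso_extend (e k) pK pp'.2 (partial_iso_converse iso1).
  have iso3 := partial_iso_converse iso2.
  have sub1 : U `<=` converse (converse (U `|` [set (e k, y)]) `|` [set (e k, x)]).
    by move=> [a b] Uab; left; left.
  exists (mk _ iso3 (subset_trans U0U sub1)); split=> //=; split.
    by exists y; left; right.
  by exists x; right.
pose W := [set u | exists k, sval (f k) u].
have WU0 : U0 `<=` W.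
  have [k0 _] := infinite_setN0 Kreg.1.
  by move=> u U0u; exists k0; case: (svalP (f k0)) => _; exact.
have Wc u v : W u -> W v -> compatible p p' u v.
  move=> [i iu] [j jv]; have [|k kP] := fdir [set i; j].
    by apply: small_finite => //; exact: finite_set2.
  have [[_ _ c] _] := svalP (f k); apply: c.
    by apply: (kP i) => //; left.
  by apply: (kP j) => //; right.
have /choice[g gP] x : exists y, W (x, y).
  by have [k <-] := eP x; have [[y yP] _] := fD k; exists y, k.
have /choice[g' gP'] y : exists x, W (x, y).
  by have [k <-] := eP y; have [_ [x xP]] := fD k; exists x, k.
have gK : cancel g g'.
  by move=> x; apply/eqP; have [_ /= -> _] := Wc _ _ (gP' (g x)) (gP x).
have gK' : cancel g' g.
  by move=> y; apply/eqP; have [_ /= <- _] := Wc _ _ (gP (g' y)) (gP' y).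
exists (Sym gK gK'); split=> [x y /WU0 Wxy|x y]; last exact: Wc.
by apply/eqP => /=; have [_ /= <- _] := Wc _ _ (gP x) Wxy.
Qed.

(** Reduces all triples to those based at [p], the only ones that [compatible] speaks of. *)
Lemma Cr_from p q r s : Cr X q r s = if p == q then Cr X p r s else
  if p == r then Cr X p s q else if p == s then Cr X p q r else
  [|| Cr X p q r && Cr X p r s, Cr X p r s && Cr X p s q | Cr X p s q && Cr X p q r].
Proof.
have [->//|pq] := eqVneq p q; have [->|pr] := eqVneq p r; first by cyc [:: q; r; s].
have [->|ps] := eqVneq p s; first by cyc [:: q; r; s].
by move: pq pr ps; cyc [:: p; q; r; s].
Qed.

Lemma homogeneous p p' (U0 : set (L * L)) : uncofinal p -> uncofinal p' ->
  (exists x, p = principal x) <-> (exists x, p' = principal x) ->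
  partial_iso p p' U0 ->
  exists g : sym L, [/\ preserving (Cr L) g, forall x y, U0 (x, y) -> g x = y &
    extend g p = p'].
Proof.
move=> pK pK' pp' /(partial_iso_total pK pK' pp')[g [gU0 gc]].
have pg : preserving (Cr L) g.
  move=> x y z; rewrite -(Cr_principal (g x)) -(Cr_principal x).
  rewrite (Cr_from p' (principal (g x))) (Cr_from p (principal x)).
  have [/= <- _ exp] := gc x y; have [/= <- _ eyp] := gc y z; have [/= <- _ ezp] := gc z x.
  by move: exp eyp ezp => /=; rewrite ![_ == p]eq_sym ![_ == p']eq_sym => -> -> ->.
exists g; split=> //.
have [_ gP] := extendP Ldense (or_introl pg : relaut g).
have pe := extend_preserving Ldense pg.
apply/eqP; apply: contrapT => /negP ne; have ne' : p' != extend g p by rewrite eq_sym.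
have [a aP] := principal_dense Ldense ne'; have [b bP] := principal_dense Ldense ne.
pose x := sym_inv_fun g a; pose y := sym_inv_fun g b.
have ga : a = g x by rewrite sym_inv_funK.
have gb : b = g y by rewrite sym_inv_funK.
have [/= cyx _ _] := gc y x.
have := pe (principal x) p (principal y); rewrite !gP -ga -gb.
rewrite -ga -gb in cyx.
have -> : Cr X (principal a) (extend g p) (principal b).
  by move: aP bP; cyc [:: p'; extend g p; principal a; principal b].
rewrite [Cr X (principal x) _ _]CrC cyx; move: aP bP.
by cyc [:: p'; extend g p; principal a; principal b].
Qed.

(** Nested intervals of [L], shrunk so as to avoid in turn every [e k] and every point of [L], close
    on a gap [p]. Any other point is excluded at some stage, and fewer than [K] stages have a common
    refinement, whose ends bound a small set away from [p] on both sides. *)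
Lemma uncofinal_avoiding (e : K -> X) :
  exists p, [/\ uncofinal p, forall x, p <> principal x & forall k, p <> e k].
Proof.
have [e' eP] := enumeration.
have [[x0 _] _ up dense] := Ldense; have [y0 xy0] := up x0.
pose P := {u : L * L | (u.1 < u.2)%O}.
pose le (u v : P) := ((sval v).1 <= (sval u).1)%O /\ ((sval u).2 <= (sval v).2)%O.
pose avoids q (u : P) := ~~ (principal (sval u).1 <= q <= principal (sval u).2)%O.
pose D k := [set u : P | avoids (e k) u /\ avoids (principal (e' k)) u].
have le_trans' u v w : le u v -> le v w -> le u w.
  by move=> [h1 h2] [h3 h4]; split; [exact: le_trans h1|exact: le_trans h4].
have avoids_le q u v : le v u -> avoids q u -> avoids q v.
  move=> [h1 h2]; apply: contraNN => /andP[h3 h4]; apply/andP; split.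
    by apply: le_trans _ h3; rewrite leNgt principal_lt -leNgt.
  by apply: le_trans h4 _; rewrite leNgt principal_lt -leNgt.
have shrink q u : exists v, le v u /\ avoids q v.
  case: u => -[a b] /= ab; have [c /andP[ac cb]] := dense _ _ ab.
  have [d' /andP[cd db]] := dense _ _ cb.
  have [h|h] := boolP (q <= principal c)%O.
    exists (exist _ (d', b) db); split; first by split=> //=; exact: ltW (lt_trans ac cd).
    rewrite /avoids /= negb_and -ltNge; apply/orP; left.
    by apply: le_lt_trans h _; rewrite principal_lt.
  exists (exist _ (a, c) ac); split; first by split=> //=; exact: ltW.
  by rewrite /avoids /= negb_and h orbT.
have [||||f [fD fdir]] := @generic_chain K Kreg P (exist _ (x0, y0) xy0) le D.
- by move=> u; split.
- exact: le_trans'.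
- move=> I f sI fchain.
  have ltI i j : I i -> I j -> ((sval (f i)).1 < (sval (f j)).2)%O.
    move=> Ii Ij; case: (fchain i j Ii Ij) => -[h1 h2].
      exact: lt_le_trans (svalP (f i)) h2.
    exact: le_lt_trans h1 (svalP (f j)).
  have [||_ _ [i Ii <-] [j Ij <-]|a [aI Ia]] := Lalpha.2
    ((fun i => (sval (f i)).1) @` I) ((fun i => (sval (f i)).2) @` I).
  - exact: small_image.
  - exact: small_image.
  - exact: ltI.
  (* A second point, between [a] and the right ends, keeps the limit interval nondegenerate. *)
  have [||_ _ -> [j Ij <-]|b [ab Ib]] := Lalpha.2 [set a] ((fun i => (sval (f i)).2) @` I).
  - by apply: small_finite => //; exact: finite_set1.
  - exact: small_image.
  - by apply: Ia; exists j.
  exists (exist _ (a, b) (ab _ erefl)) => i Ii; split; apply: ltW.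
    by apply: aI; exists i.
  by apply: Ib; exists i.
- move=> k u; have [v [vu av]] := shrink (e k) u.
  have [w [wv aw]] := shrink (principal (e' k)) v; exists w.
  by split; [exact: le_trans' vu|split=> //; exact: avoids_le av].
have dir i j : exists k, le (f k) (f i) /\ le (f k) (f j).
  have [|k kP] := fdir [set i; j].
    by apply: small_finite => //; exact: finite_set2.
  by exists k; split; apply: kP; [left|right].
have [k0 _] := infinite_setN0 Kreg.1.
have [|p [pge ple]] := @dedekind_sup _ _ Ldense [set principal (sval (f k)).1 | k in setT].
  by exists (principal (sval (f k0)).1), k0.
have ap k : (principal (sval (f k)).1 <= p)%O by apply: pge; exists k.
have pb k : (p <= principal (sval (f k)).2)%O.
  apply: ple => _ [j _ <-]; have [i [[_ ik] [ij _]]] := dir k j.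
  apply: ltW; rewrite principal_lt.
  exact: le_lt_trans ij (lt_le_trans (svalP (f i)) ik).
have avp k q : avoids q (f k) -> p <> q.
  by move=> aq pq; move: aq; rewrite /avoids -pq ap pb.
have px x : p != principal x.
  by have [k <-] := eP x; apply/eqP/(@avp k); case: (fD k).
exists p; split=> [U sU nUp|x|k]; last 2 first.
- exact/eqP.
- by apply: (@avp k); case: (fD k).
have /choice[i iP] u : exists k, u <> p ->
    (u < principal (sval (f k)).1)%O || (principal (sval (f k)).2 < u)%O.
  have [->|/eqP up'] := pselect (u = p); first by exists k0.
  case: (ltgtP u p) up' => // [up'|pu] _.
    have [x /andP[ux xp]] := principal_between Ldense up'; have [k ek] := eP x.
    exists k => _; have [_] := fD k; rewrite /avoids /= ek negb_and -!ltNge => /orP[h|h].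
      by rewrite (lt_trans ux h).
    by have := lt_trans h xp; rewrite ltNge pb.
  have [x /andP[ux xp]] := principal_between Ldense pu; have [k ek] := eP x.
  exists k => _; have [_] := fD k; rewrite /avoids /= ek negb_and -!ltNge => /orP[h|h].
    by have := lt_trans ux h; rewrite ltNge ap.
  by rewrite (lt_trans h xp) orbT.
have [k kP] := fdir (i @` U) (small_image i sU).
have kU u : U u -> (u < principal (sval (f k)).1)%O || (principal (sval (f k)).2 < u)%O.
  move=> Uu; have /iP : u <> p by move=> up'; apply: nUp; rewrite -up'.
  have [h1 h2] : le (f k) (f (i u)) by apply: kP; exists u.
  case/orP=> h; apply/orP; [left|right].
    by apply: lt_le_trans h _; rewrite leNgt principal_lt -leNgt.
  by apply: le_lt_trans _ h; rewrite leNgt principal_lt -leNgt.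
split; [exists (principal (sval (f k)).2)|exists (principal (sval (f k)).1)] => u /kU;
  move: (ap k) (pb k) (px (sval (f k)).1) (px (sval (f k)).2); rewrite !leNgt;
  by cyc [:: p; u; principal (sval (f k)).1; principal (sval (f k)).2].
Qed.

End AlphaSet.

(** * Automorphism groups *)

Lemma morphism_one (G H : groupType) (f : G -> H) : {morph f : x y / x * y} -> f 1 = 1.
Proof. by move=> fM; apply: (mulgI (f 1)); rewrite -fM !mulg1. Qed.

Definition group_morphism (G H : groupType) (f : G -> H)
    (fM : {morph f : x y / x * y}) : UMagmaMorphism.type G H :=
  HB.pack f (isUMagmaMorphism.Build G H f (conj (morphism_one fM) fM)).

Section CircleGroups.
Context {d : Order.disp_t} {T : orderType d}.
Local Notation aut := (circle_aut (Cr T)).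
Local Notation rel := (circle_relaut (Cr T)).

Lemma aut_preserving (g : aut) : preserving (Cr T) g.
Proof. by have /asboolP := circle_autP g. Qed.

Lemma rel_relaut (g : rel) : relaut (g : sym T).
Proof. by have /asboolP := circle_relautP g. Qed.

Lemma aut_relaut (g : aut) : relaut (g : sym T).
Proof. by left; exact: aut_preserving. Qed.

Definition aut_of (g : sym T) (pg : preserving (Cr T) g) : aut :=
  @CircleAut _ _ g (asboolT pg).

Definition rel_of (g : sym T) (rg : relaut g) : rel :=
  @CircleRelaut _ _ g (asboolT rg).

Lemma autM (g h : aut) : (g * h : aut) = (g : sym T) * (h : sym T) :> sym T.
Proof. by []. Qed.
Lemma relM (g h : rel) : (g * h : rel) = (g : sym T) * (h : sym T) :> sym T.
Proof. by []. Qed.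
Lemma relV (g : rel) : (g^-1 : rel) = (g : sym T)^-1 :> sym T.
Proof. by []. Qed.

Lemma aut_inj (g h : aut) : (g : sym T) = (h : sym T) -> g = h.
Proof. exact: val_inj. Qed.
Lemma rel_inj (g h : rel) : (g : sym T) = (h : sym T) -> g = h.
Proof. exact: val_inj. Qed.

Lemma relaut_conj_preserving (t : sym T) (g : sym T) : relaut t ->
  preserving (Cr T) g -> preserving (Cr T) (t * g * t^-1 : sym T).
Proof.
move=> [tp|tr] gp x y z /=.
  by rewrite tp gp -tp !sym_inv_funK.
by rewrite tr gp -tr !sym_inv_funK.
Qed.

Definition conj_aut (t : rel) (g : aut) : aut :=
  aut_of (relaut_conj_preserving (rel_relaut t) (aut_preserving g)).

Lemma conj_autE t g : conj_aut t g = (t : sym T) * g * (t : sym T)^-1 :> sym T.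
Proof. by []. Qed.

Lemma conj_autK t : cancel (conj_aut t) (conj_aut t^-1).
Proof.
by move=> g; apply: aut_inj; rewrite !conj_autE relV invgK !mulgA mulVg mul1g mulgVK.
Qed.

Lemma conj_autVK t : cancel (conj_aut t^-1) (conj_aut t).
Proof. by move=> g; rewrite -{1}[t]invgK conj_autK. Qed.

Lemma conj_autM t : {morph conj_aut t : g h / g * h}.
Proof.
by move=> g h; apply: aut_inj; rewrite autM !conj_autE autM !mulgA mulgVK.
Qed.

Definition inner (t : rel) : group_aut aut :=
  @GroupAut _ (Sym (@conj_autK t) (@conj_autVK t)) (asboolT (@conj_autM t)).

Lemma innerM : {morph inner : t u / t * u}.
Proof.
move=> t u; apply: val_inj; apply: sym_ext => g; apply: aut_inj.
rewrite [LHS](conj_autE (t * u) g) [RHS](conj_autE t (conj_aut u g)) conj_autE.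
by rewrite relM invgM !mulgA.
Qed.

(** The trivial centralizer of the smaller group gives at once the uniqueness of the conjugating
    element, injectivity of the map to automorphisms, and the trivial center of the larger group. *)
Lemma complete_circle :
  (forall phi : group_aut aut, exists t : sym T, relaut t /\ is_conjugation phi t) ->
  (forall phi : group_aut rel, exists t : sym T, relaut t /\
     forall g : rel, (phi g : sym T) = t * (g : sym T) * t^-1) ->
  (forall t : sym T, relaut t -> (forall g : aut, commute t (g : sym T)) -> t = 1) ->
  [/\ (forall phi : group_aut aut, exists! t : rel, is_conjugation phi t),
      (forall t : rel, exists phi : group_aut aut, is_conjugation phi t),
      (exists Phi : {multiplicative rel -> group_aut aut},
        bijective Phi /\ forall t, is_conjugation (Phi t) t)
    & complete_group rel].
Proof.
move=> conjA conjR cent.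
have uniq (phi : group_aut aut) (t u : rel) :
    is_conjugation phi t -> is_conjugation phi u -> t = u.
  move=> tP uP; apply: rel_inj; apply: (mulgI (u : sym T)^-1); rewrite mulVg.
  apply: cent; first exact: relaut_comp (relaut_sym_inv (rel_relaut u)) (rel_relaut t).
  move=> g; have := tP g; rewrite uP => /(congr1 (fun h => (u : sym T)^-1 * h * t)).
  by rewrite /commute !mulgA mulVg mul1g !mulgVK.
have innerP t : is_conjugation (inner t) t by move=> g.
split.
- move=> phi; have [t [rt tP]] := conjA phi.
  exists (rel_of rt); split=> // u; exact: uniq.
- by move=> t; exists (inner t).
- pose Phi : {multiplicative rel -> group_aut aut} := group_morphism innerM.
  have PhiE t : Phi t = inner t by [].
  exists Phi; split=> //.
  have /choice[f fP] phi : exists t, inner t = phi.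
    have [t [rt tP]] := conjA phi; exists (rel_of rt).
    apply: val_inj; apply: sym_ext => g; apply: aut_inj.
    by rewrite tP.
  exists f => [t|phi]; rewrite !PhiE; last exact: fP.
  by apply: (uniq (inner t)) => //; have := innerP (f (inner t)); rewrite fP.
- split=> [z zc|phi].
    apply: rel_inj; apply: cent; first exact: rel_relaut.
    move=> g; have := zc (rel_of (aut_relaut g)).
    by move=> /(congr1 (@circle_relaut_val _ _)).
  have [t [rt tP]] := conjR phi; exists (rel_of rt) => g; apply: rel_inj.
  by rewrite tP.
Qed.

End CircleGroups.

(** * Automorphisms supported in an arc *)

Section Patch.
Context {d : Order.disp_t} {T : orderType d}.
Implicit Types (a b x y z : T).

(** Fixing both endpoints, [f] maps the arc onto itself. Up to rotation of a triple only the number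
    of its points in the arc matters, whence [one] and [two]. *)
Lemma patch (f : sym T) a b : preserving (Cr T) f -> f a = a -> f b = b ->
  exists g : sym T, preserving (Cr T) g /\
    forall x, g x = if Cr T a x b then f x else x.
Proof.
move=> pf fa fb; have arcE x : Cr T a (f x) b = Cr T a x b by rewrite -{1}fa -{1}fb pf.
have arcV x : Cr T a (sym_inv_fun f x) b = Cr T a x b by rewrite -arcE sym_inv_funK.
pose g x := if Cr T a x b then f x else x.
pose h x := if Cr T a x b then sym_inv_fun f x else x.
have gK : cancel g h.
  move=> x; rewrite /g /h; have [ax|/negbTE ax] := boolP (Cr T a x b); last by rewrite ax.
  by rewrite arcE ax sym_funK.
have hK : cancel h g.
  move=> x; rewrite /g /h; have [ax|/negbTE ax] := boolP (Cr T a x b); last by rewrite ax.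
  by rewrite arcV ax sym_inv_funK.
exists (Sym gK hK); split=> //=; apply: Cr_homo => x y z.
have one u v w : Cr T a u b -> ~~ Cr T a v b -> ~~ Cr T a w b ->
    Cr T u v w -> Cr T (f u) v w.
  move=> au; have := au; rewrite -arcE.
  by move: au; cyc [:: a; b; u; f u; v; w].
have two u v w : Cr T a u b -> Cr T a v b -> ~~ Cr T a w b ->
    Cr T u v w -> Cr T (f u) (f v) w.
  move=> au av nw uvw; have auv : Cr T a u v by move: au av nw uvw; cyc [:: a; b; u; v; w].
  have := pf a u v; rewrite auv fa; rewrite -arcE in au; rewrite -arcE in av.
  by move: au av nw; cyc [:: a; b; f u; f v; w].
rewrite /g; case: ifPn => ax; case: ifPn => ay; case: ifPn => az //.
- by rewrite pf.
- exact: two.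
- by move=> xyz; rewrite -CrC; apply: two => //; rewrite CrC.
- exact: one.
- by move=> xyz; rewrite CrC; apply: two => //; rewrite -CrC.
- by move=> xyz; rewrite CrC; apply: one => //; rewrite -CrC.
- by move=> xyz; rewrite -CrC; apply: one => //; rewrite CrC.
Qed.

End Patch.

Section Reconstruct.
Variables (K : Type) (Kreg : regular_cardinal K).
Context {d : Order.disp_t} {L : orderType d}.
Hypothesis Lalpha : alpha_set K L.
Local Notation X := (dedekind L).
Implicit Types (x y z : L) (a b p q r : X).
Let Ldense := alpha_unbounded_dense Kreg Lalpha.

(** Points [u] and [v] of [L] are chosen in the arc on both sides of [x] and [y]; homogeneity moves
    [x] to [y] fixing [u] and [v], and [patch] cuts the map down to the arc from [u] to [v]. *)
Lemma arc_transitive a b (x y : L) : Cr X a (principal x) b -> Cr X a (principal y) b ->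
  exists g : sym L, [/\ preserving (Cr L) g, g x = y &
    forall p, extend g p != p -> Cr X a p b].
Proof.
move=> axb ayb.
have [|u au] := principal_dense Ldense (a := a)
  (b := if Cr X a (principal x) (principal y) then principal x else principal y).
  by case: ifP; move: axb ayb; cyc [:: a; b; principal x; principal y].
have [|v vb] := principal_dense Ldense (b := b)
  (a := if Cr X a (principal x) (principal y) then principal y else principal x).
  by case: ifP; move: axb ayb; cyc [:: a; b; principal x; principal y].
have [ux yv aub] : [/\ Cr X a (principal u) (principal x),
    Cr X (principal y) (principal v) b & Cr X a (principal u) (principal y)].
  by case: ifP au vb => h au vb; split; move: h au vb axb ayb;
    cyc [:: a; b; principal x; principal y; principal u; principal v].
have xv : Cr X (principal x) (principal v) b.
  by case: ifP vb => h vb; move: h vb axb ayb;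
    cyc [:: a; b; principal x; principal y; principal v].
have uxv : Cr X (principal u) (principal x) (principal v).
  by move: axb ux xv; cyc [:: a; b; principal x; principal u; principal v].
have uyv : Cr X (principal u) (principal y) (principal v).
  by move: ayb aub yv; cyc [:: a; b; principal y; principal u; principal v].
have avb : Cr X a (principal v) b.
  by move: ayb yv; cyc [:: a; b; principal y; principal v].
have auv : Cr X a (principal u) (principal v).
  by move: yv aub ayb; cyc [:: a; b; principal y; principal u; principal v].
have uK := @uncofinal_principal K Kreg _ _ Lalpha u.
(* Taking [u] as base point on both sides makes it fixed; [v] is fixed through the second prescribed
   pair. *)
have [|f [pf fU eu]] := @homogeneous K Kreg _ _ Lalpha (principal u) (principal u)
    [set (x, y); (v, v)] uK uK (conj id id).
  split.
  - by apply: small_finite => //; apply: finite_image; exact: finite_set2.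
  - by apply: small_finite => //; apply: finite_image; exact: finite_set2.
  - have xv' : (x == v) = false.
      by apply/negbTE; rewrite -principal_eq; move: uxv;
        cyc [:: principal u; principal x; principal v].
    have yv' : (y == v) = false.
      by apply/negbTE; rewrite -principal_eq; move: uyv;
        cyc [:: principal u; principal y; principal v].
    move=> s t [->|->] [->|->]; split;
      rewrite /= ?eqxx ?xv' ?yv' // 1?eq_sym ?xv' 1?eq_sym ?yv' //;
      by move: uxv uyv; cyc [:: principal u; principal x; principal y; principal v].
have [_ fP] := extendP Ldense (or_introl pf : relaut f).
have fu : f u = u by apply: principal_inj; rewrite -fP.
have fv : f v = v by apply: fU; right.
have [g [pg gP]] := patch pf fu fv.
exists g; split=> //; first by rewrite gP -Cr_principal uxv; apply: fU; left.
move=> p gp; apply: contrapT => /negP nap.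
have rg : relaut g by left.
have [re eP] := extendP Ldense rg.
(* The point [p] may be a gap, about which [patch] says nothing directly; were it moved, nearby
   points of [L] would be moved too. *)
have [a' [b' [apb' nab]]] := wiggle (dedekind_dense Ldense) re gp.
have vpu : Cr X (principal v) p (principal u).
  by move: nap auv aub avb ayb uyv; cyc [:: a; b; p; principal u; principal v; principal y].
have [c [e [cpe ce]]] := arc_inter apb' vpu.
have [_ _ ce'] := Cr_neq cpe; have [z czee] := principal_dense Ldense ce'.
have [/nab + vzu] := ce _ czee; rewrite eP gP.
case: ifPn => [|_]; last by have [-> _] := ce _ czee.
by rewrite -Cr_principal; move: vzu; cyc [:: principal u; principal v; principal z].
Qed.

Lemma arc_mixing a b a1 b1 a2 b2 : a1 != b1 -> a2 != b2 ->
  (forall p, Cr X a1 p b1 -> Cr X a p b) -> (forall p, Cr X a2 p b2 -> Cr X a p b) ->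
  exists g : sym L, preserving (Cr L) g /\ exists p,
    [/\ forall q, extend g q != q -> Cr X a q b, Cr X a1 p b1 & Cr X a2 (extend g p) b2].
Proof.
move=> ab1 ab2 s1 s2; have [x xP] := principal_dense Ldense ab1.
have [y yP] := principal_dense Ldense ab2.
have [g [pg gxy gab]] := arc_transitive (s1 _ xP) (s2 _ yP).
exists g; split=> //; exists (principal x); split=> //.
by have [_ ->] := extendP Ldense (or_introl pg : relaut g); rewrite gxy.
Qed.

Lemma arc_moving a b : a != b -> exists g : sym L, preserving (Cr L) g /\
  (forall q, extend g q != q -> Cr X a q b) /\ exists x, g x != x.
Proof.
move=> ab; have [x xP] := principal_dense Ldense ab; have [ax xb _] := Cr_neq xP.
have [y yP] := principal_dense Ldense ax.
have ayb : Cr X a (principal y) b.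
  by move: xP yP; cyc [:: a; b; principal x; principal y].
have [g [pg gxy gab]] := arc_transitive xP ayb.
exists g; split=> //; split=> //; exists x; rewrite gxy -principal_eq.
by move: yP; cyc [:: a; principal x; principal y].
Qed.

Lemma two_points : exists a b : X, a != b.
Proof.
have [[x _] _ up _] := Ldense; have [y xy] := up x.
by exists (principal x), (principal y); rewrite principal_eq; move: xy; cyc [:: x; y].
Qed.

(** * Reconstruction for groups acting on the completed circle *)

Section Lift.
Variables (G : groupType) (rho : UMagmaMorphism.type G (sym X)).
Hypothesis rho_inj : injective rho.
Hypothesis rho_rel : forall g, relaut (rho g).
(** The extended automorphisms of [L] already provide mixing, and all four groups contain them. *)
Hypothesis rho_lift : forall g : sym L, preserving (Cr L) g -> exists g', rho g' = extend g.

Lemma group_reconstruction (phi : group_aut G) :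
  exists t : sym X, relaut t /\ forall g, rho (phi g) = t * rho g * t^-1.
Proof.
have /asboolP phiM := group_autP phi.
have psiM : {morph (sym_inv_fun phi) : g h / g * h}.
  by move=> g h; apply: (can_inj (sym_funK phi)); rewrite phiM !sym_inv_funK.
apply: (@reconstruction _ X G rho rho_inj rho_rel (dedekind_dense Ldense) _
  (dedekind_arc_complete Ldense) two_points (group_morphism phiM) (group_morphism psiM)).
- move=> a b a1 b1 a2 b2 ab1 ab2 s1 s2.
  have [g [pg [p [gab p1 p2]]]] := arc_mixing ab1 ab2 s1 s2.
  have [g' g'E] := rho_lift pg; exists g', p.
  by split; rewrite ?g'E // => q; rewrite /moves g'E; exact: gab.
- exact: sym_funK.
- exact: sym_inv_funK.
Qed.

Hypothesis rho_principal : forall g x, exists y, rho g (principal x) = principal y.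

(* Otherwise the orbit of [t (principal x)], which contains every uncofinal gap,
   would be contained in the image of [L] under [t]. *)
Lemma conj_principal (phi psi : G -> G) (t : sym X) : cancel psi phi -> relaut t ->
  (forall g, rho (phi g) = t * rho g * t^-1) ->
  forall x, exists y, t (principal x) = principal y.
Proof.
move=> psiK rt tP x; apply: contrapT => nx.
have [e eP] := enumeration Kreg Lalpha.
have [p [pK np pe]] := @uncofinal_avoiding K Kreg _ _ Lalpha (fun k => t (principal (e k))).
have qK := uncofinal_relaut rt (@uncofinal_principal K Kreg _ _ Lalpha x).
have [||g [pg _ gp]] := @homogeneous K Kreg _ _ Lalpha (t (principal x)) p set0 qK pK.
- by split=> [[y ty]|[y py]]; [case: nx; exists y|case: (np y)].
- by split=> //; rewrite image_set0; exact/small_finite/finite_set0.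
(* Written as [phi (psi g')], the element carrying [t (principal x)] to [p] sends it to
   [t (principal y)], a value that [p] was chosen to avoid. *)
have [g' g'E] := rho_lift pg; have [y yP] := rho_principal (psi g') x.
have [k ek] := eP y; apply: (pe k); rewrite ek -gp -g'E -[g']psiK tP /= sym_funK.
by rewrite yP.
Qed.

End Lift.

End Reconstruct.

(** * Descent to the chain, and centralizers *)

Section Main.
Variables (K : Type) (Kreg : regular_cardinal K).
Context {d : Order.disp_t} {L : orderType d}.
Hypothesis Lalpha : alpha_set K L.
Local Notation X := (dedekind L).
Let Ldense := alpha_unbounded_dense Kreg Lalpha.

Lemma descend (t : sym X) : relaut t ->
  (forall x, exists y, t (principal x) = principal y) ->
  (forall x, exists y, t^-1 (principal x) = principal y) ->
  exists u : sym L, relaut u /\ extend u = t.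
Proof.
move=> rt /choice[f fP] /choice[g gP].
have fK : cancel f g by move=> x; apply: principal_inj; rewrite -gP -fP /= sym_funK.
have gK : cancel g f by move=> x; apply: principal_inj; rewrite -fP -gP /= sym_inv_funK.
have ru : relaut (Sym fK gK).
  by case: rt => rt; [left|right] => x y z;
    rewrite -[LHS]Cr_principal -[RHS]Cr_principal /= -!fP rt.
exists (Sym fK gK); split=> //; apply: (extend_unique Ldense) => //.
Qed.

(** The conjugating map found on the completion restricts to a bijection of [L] because
    [conj_principal] applies to [phi] and, with the inverse map, to its inverse. *)
Lemma alpha_set_reconstruction (G : groupType) (v : UMagmaMorphism.type G (sym L))
    (phi : group_aut G) :
  injective v -> (forall g, relaut (v g)) ->
  (forall g : sym L, preserving (Cr L) g -> exists g', v g' = g) ->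
  exists u : sym L, relaut u /\ forall g, v (phi g) = u * v g * u^-1.
Proof.
move=> v_inj v_rel v_lift.
have extM : {morph (fun g => extend (v g)) : g h / g * h}.
  by move=> g h; rewrite gmulfM (extendM Ldense (v_rel g) (v_rel h)).
pose rho := group_morphism extM.
have rho_inj : injective rho by move=> g h /(extend_inj Ldense (v_rel g) (v_rel h))/v_inj.
have rho_rel g : relaut (rho g) by case: (extendP Ldense (v_rel g)).
have rho_lift (g : sym L) : preserving (Cr L) g -> exists g', rho g' = extend g.
  by move=> /v_lift[g' g'E]; exists g'; rewrite -g'E.
have rho_principal g x : exists y, rho g (principal x) = principal y.
  by exists (v g x); have [_ ->] := extendP Ldense (v_rel g).
have [t [rt tP]] := group_reconstruction Kreg Lalpha rho_inj rho_rel rho_lift phi.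
have [||u [ru ut]] := @descend t rt.
- exact: (conj_principal Kreg Lalpha rho_lift rho_principal (sym_inv_funK phi) rt tP).
- apply: (conj_principal Kreg Lalpha rho_lift rho_principal (sym_funK phi)).
    exact: relaut_sym_inv.
  by move=> g; rewrite -[g in RHS](sym_inv_funK phi) tP invgK !mulgA mulVg mul1g mulgVK.
exists u; split=> // g; apply: (mulIg u); rewrite mulgVK.
apply: (extend_inj Ldense); [exact: relaut_comp|exact: relaut_comp|].
rewrite (extendM Ldense (v_rel _) ru) (extendM Ldense ru (v_rel _)) ut.
by apply: (mulIg t^-1); rewrite mulgK; exact: tP.
Qed.

(** If [t] is not the identity, it moves some arc off itself and cannot commute with a nontrivial
    element supported in that arc. *)
Lemma alpha_set_centralizer (t : sym L) : relaut t ->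
  (forall g : circle_aut (Cr L), commute t (g : sym L)) -> t = 1.
Proof.
move=> rt tc; apply: sym_ext => x /=; apply/eqP; apply: contrapT => /negP tx.
have [a [b [/Cr_neq[_ _ ab] nab]]] := wiggle (dense_circle Ldense) rt tx.
have [|g [pg [gab [y gy]]]] := @arc_moving K Kreg _ _ Lalpha (principal a) (principal b).
  by rewrite principal_eq.
have [_ eP] := extendP Ldense (or_introl pg : relaut g).
have {}gab z : g z != z -> Cr L a z b.
  by move=> gz; rewrite -Cr_principal; apply: gab; rewrite eP principal_eq.
have := congr1 (fun h : sym L => h y) (tc (aut_of pg)) => /= tgy.
have gty : g (t y) = t y by apply: contraNeq (nab _ (gab _ gy)) => /gab.
by move: gy; rewrite -(can_eq (sym_funK t)) tgy gty eqxx.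
Qed.

Lemma dedekind_centralizer (t : sym X) : relaut t ->
  (forall g : circle_aut (Cr X), commute t (g : sym X)) -> t = 1.
Proof.
move=> rt tc; apply: sym_ext => p /=; apply/eqP; apply: contrapT => /negP tp.
have [a [b [/Cr_neq[_ _ ab] nab]]] := wiggle (dedekind_dense Ldense) rt tp.
have [g [pg [gab [y gy]]]] := arc_moving Kreg Lalpha ab.
have [_ eP] := extendP Ldense (or_introl pg : relaut g).
have ey : extend g (principal y) != principal y by rewrite eP principal_eq.
have := congr1 (fun h : sym X => h (principal y))
  (tc (aut_of (extend_preserving Ldense pg))) => /= tgy.
have gty : extend g (t (principal y)) = t (principal y).
  by apply: contraNeq (nab _ (gab _ ey)) => /gab.
by move: ey; rewrite -(can_eq (sym_funK t)) tgy gty eqxx.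
Qed.

End Main.

Theorem theorem9p8 (gch : GCH) (K : Type) (Kreg : regular_cardinal K)
    (d : Order.disp_t) (L : orderType d) (Lalpha : alpha_set K L) :
  [/\ (forall phi : group_aut (circle_aut (Cr L)),
        exists! tau : circle_relaut (Cr L), is_conjugation phi tau),
      (forall tau : circle_relaut (Cr L),
        exists phi : group_aut (circle_aut (Cr L)), is_conjugation phi tau),
      (exists Phi : {multiplicative circle_relaut (Cr L) ->
                                    group_aut (circle_aut (Cr L))},
        bijective Phi /\ forall tau, is_conjugation (Phi tau) tau)
    & complete_group (circle_relaut (Cr L))]
  /\
  [/\ (forall phi : group_aut (circle_aut (Cr (dedekind L))),
        exists! tau : circle_relaut (Cr (dedekind L)), is_conjugation phi tau),
      (forall tau : circle_relaut (Cr (dedekind L)),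
        exists phi : group_aut (circle_aut (Cr (dedekind L))),
          is_conjugation phi tau),
      (exists Phi : {multiplicative circle_relaut (Cr (dedekind L)) ->
                                    group_aut (circle_aut (Cr (dedekind L)))},
        bijective Phi /\ forall tau, is_conjugation (Phi tau) tau)
    & complete_group (circle_relaut (Cr (dedekind L)))].
Proof.
have Ldense := alpha_unbounded_dense Kreg Lalpha.
split; apply: complete_circle.
- move=> phi.
  have [|||u [ru uP]] := @alpha_set_reconstruction K Kreg _ _ Lalpha _
    (group_morphism (@autM _ L)) phi.
  + exact: aut_inj.
  + exact: aut_relaut.
  + by move=> g pg; exists (aut_of pg).
  by exists u.
- move=> phi.
  have [|||u [ru uP]] := @alpha_set_reconstruction K Kreg _ _ Lalpha _
    (group_morphism (@relM _ L)) phi.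
  + exact: rel_inj.
  + exact: rel_relaut.
  + by move=> g pg; exists (rel_of (or_introl pg)).
  by exists u.
- exact: (alpha_set_centralizer Kreg Lalpha).
- move=> phi.
  have [|||t [rt tP]] := @group_reconstruction K Kreg _ _ Lalpha _
    (group_morphism (@autM _ (dedekind L))) _ _ _ phi.
  + exact: aut_inj.
  + exact: aut_relaut.
  + by move=> g pg; exists (aut_of (extend_preserving Ldense pg)).
  by exists t.
- move=> phi.
  have [|||t [rt tP]] := @group_reconstruction K Kreg _ _ Lalpha _
    (group_morphism (@relM _ (dedekind L))) _ _ _ phi.
  + exact: rel_inj.
  + exact: rel_relaut.
  + by move=> g pg; exists (rel_of (or_introl (extend_preserving Ldense pg))).
  by exists t.
- exact: (dedekind_centralizer Kreg Lalpha).
Qed.
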